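(* Let $t\in\mathfrak o^\times$ and let $\chi=\chi_{1,1,t}$ be the associated affine generic character with trivial central character. The representations $\sigma_\chi^{+}$ and $\sigma_\chi^-$ of $\mathrm{GSp}_4(F)$ have conductor exponent $a(\sigma_\chi^\pm)=5$.
   Context: $F$ is a non-archimedean local field of characteristic zero with ring of integers $\mathfrak o$, maximal ideal $\mathfrak p$, uniformizer $\varpi$. $\psi$ is a character of $F$ trivial on $\mathfrak o$ but not on $\mathfrak p^{-1}$, and $\psi_0(x)=\psi(\varpi^{-1}x)$. $G=\mathrm{GSp}_4(F)=\{g\in\mathrm{GL}_4(F):{}^tgJg=\mu(g)J,\ \mu(g)\in F^\times\}$ with $J=\begin{bmatrix}&&&1\\&&1\\&-1\\-1\end{bmatrix}$; $Z$ is its center. Let $K'=G\cap\begin{bmatrix}1+\mathfrak p&\mathfrak o&\mathfrak o&\mathfrak o\\\mathfrak p&1+\mathfrak p&\mathfrak o&\mathfrak o\\\mathfrak p&\mathfrak p&1+\mathfrak p&\mathfrak o\\\mathfrak p&\mathfrak p&\mathfrak p&1+\mathfrak p\end{bmatrix}$ and $H=ZK'$. For $t\in\mathfrak o^\times$, $\chi=\chi_{1,1,t}:H\to\mathbb C^\times$ is $\chi(zk)=\psi_0(k_{12}+k_{23}+t\varpi^{-1}k_{41})$ for $z\in Z$, $k\in K'$ (trivial central character). Let $g_\chi=\begin{bmatrix}0&0&1&0\\0&0&0&-1\\-\varpi/t&0&0&0\\0&\varpi/t&0&0\end{bmatrix}$, $H'=H\sqcup g_\chi H$, and $\chi^\pm:H'\to\mathbb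 C^\times$, $\chi^\pm(h)=\chi(h)$, $\chi^\pm(g_\chi h)=\pm\chi(h)$ for $h\in H$. Then $\sigma_\chi^\pm=\text{c-Ind}_{H'}^G(\chi^\pm)$; these are irreducible supercuspidal representations with trivial central character, called simple supercuspidal representations. Paramodular group of level $n\ge0$: $K(\mathfrak p^n)=\{k\in G\cap\begin{bmatrix}\mathfrak o&\mathfrak o&\mathfrak o&\mathfrak p^{-n}\\\mathfrak p^n&\mathfrak o&\mathfrak o&\mathfrak o\\\mathfrak p^n&\mathfrak o&\mathfrak o&\mathfrak o\\\mathfrak p^n&\mathfrak p^n&\mathfrak p^n&\mathfrak o\end{bmatrix}:\det k\in\mathfrak o^\times\}$. For an irreducible admissible generic representation $\pi$ of $G$ with trivial central character, $\pi$ has a non-zero $K(\mathfrak p^n)$-fixed vector if and only if $n\ge a(\pi)$, where $a(\pi)$ is the conductor exponent of $\pi$; so $a(\pi)$ is the smallest $n\geq 0$ such that $\pi$ has a non-zero $K(\mathfrak p^n)$-fixed vector. *)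

(* Defs.v *)
From HB Require Import structures.
From mathcomp Require Import all_boot all_order all_algebra.
From mathcomp Require Import all_classical all_reals topology.
From mathcomp Require Import complex ring.

Set Implicit Arguments.
Unset Strict Implicit.
Unset Printing Implicit Defensive.

Import Order.TTheory GRing.Theory Num.Theory.

Local Open Scope classical_set_scope.
Local Open Scope ring_scope.

(* Non-archimedean local fields of characteristic zero: fields of
   characteristic zero, complete for the topology of a normalized discrete
   valuation, with finite residue field.  The value [valuation 0] is
   irrelevant and is never used. *)
HB.mixin Record Field_isLocal F of GRing.Field F & Complete F := {
  valuation : F -> int;
  valM : forall x y : F, x != 0 -> y != 0 -> valuation (x * y) = valuation x + valuation y;
  valD : forall x y : F, x != 0 -> y != 0 -> x + y != 0 ->
    Num.min (valuation x) (valuation y) <= valuation (x + y);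
  val_surj : exists2 x : F, x != 0 & valuation x = 1;
  entourage_val : forall A : set (F * F), entourage A <->
    exists n : int, forall x y : F, x = y \/ n <= valuation (x - y) -> A (x, y);
  residue_finite : exists s : seq F, forall x : F, x = 0 \/ 0 <= valuation x ->
    exists2 y, y \in s & x = y \/ 1 <= valuation (x - y);
  pchar_local : [pchar F] =i pred0
}.

#[short(type="localFieldType")]
HB.structure Definition LocalField :=
  { F of GRing.Field F & Complete F & Field_isLocal F }.

Arguments valM {s x y}.
Arguments valD {s x y}.

Section LocalFieldTheory.
Variable F : localFieldType.
Implicit Types (x y : F) (n : int).

(* [x \in pow_p n] means that [x] lies in the fractional ideal p^n; so
   [pow_p 0] is the ring of integers o, and [pow_p 1] its maximal ideal. *)
Definition pow_p n : {pred F} := [pred x | (x == 0) || (n <= valuation x)].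

Definition o_unit x := (x != 0) && (valuation x == 0).

Definition uniformizer x := (x != 0) && (valuation x == 1).

Lemma val1 : valuation (1 : F) = 0.
Proof.
have := valM (oner_neq0 F) (oner_neq0 F).
by rewrite mulr1 => /eqP; rewrite -subr_eq subrr eq_sym => /eqP.
Qed.

Lemma valN x : x != 0 -> valuation (- x) = valuation x.
Proof.
move=> x0; have N10 : (-1 : F) != 0 by rewrite oppr_eq0 oner_eq0.
have := valM N10 N10; rewrite mulrNN mulr1 val1 => h.
rewrite -mulN1r valM //; suff -> : valuation (-1 : F) = 0 by rewrite add0r.
by apply/eqP; move/esym/eqP: h; rewrite -mulr2n mulrn_eq0.
Qed.

Lemma pow_p0 n : 0 \in pow_p n.
Proof. by rewrite inE eqxx. Qed.

Lemma pow_pN n x : x \in pow_p n -> - x \in pow_p n.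
Proof.
rewrite !inE oppr_eq0; case: eqP => //= /eqP x0.
by rewrite valN.
Qed.

Lemma pow_pD n x y : x \in pow_p n -> y \in pow_p n -> x + y \in pow_p n.
Proof.
rewrite !inE; have [->|x0] := eqVneq x 0; first by rewrite add0r.
have [->|y0] := eqVneq y 0; first by rewrite addr0 => /= h _; rewrite (negPf x0).
have [//|s0] /= := eqVneq (x + y) 0 => nx ny.
by apply: le_trans (valD x0 y0 s0); rewrite le_min nx ny.
Qed.

Lemma pow_pM n m x y : x \in pow_p n -> y \in pow_p m -> x * y \in pow_p (n + m).
Proof.
rewrite !inE mulf_eq0; have [->//|x0] := eqVneq x 0.
have [->//|y0] /= := eqVneq y 0 => nx my.
by rewrite valM // lerD.
Qed.

Lemma pow_p_le n m x : m <= n -> x \in pow_p n -> x \in pow_p m.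
Proof. by move=> mn; rewrite !inE => /orP[->//|/(le_trans mn)->]; rewrite orbT. Qed.

End LocalFieldTheory.

Section GSp4.
Variable F : localFieldType.
Local Notation M4 := 'M[F]_4.
Local Notation "k `[ i , j ]" := ((k : M4) (inord i) (inord j))
  (at level 2, format "k `[ i ,  j ]").

Definition mx4 (rows : seq (seq F)) : M4 :=
  \matrix_(i, j) nth 0 (nth [::] rows i) j.

Definition J : M4 := mx4
  [:: [:: 0;  0;   0; 1];
      [:: 0;  0;   1; 0];
      [:: 0; -1;   0; 0];
      [:: -1; 0;   0; 0] ].

Definition GSp4 : set M4 :=
  [set g | g \in unitmx /\ exists2 mu : F, mu != 0 & g^T *m J *m g = mu *: J].

(* The group K' (pro-unipotent radical of the Iwahori subgroup). *)
Definition Kprime : set M4 :=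
  [set k | GSp4 k /\ forall i j : 'I_4,
     k i j - (i == j)%:R \in pow_p (if (i < j)%N then 0 else 1)].

Lemma Kprime_diag (m : M4) i : Kprime m -> m i i != 0 /\ valuation (m i i) = 0.
Proof.
move=> [_ /(_ i i)]; rewrite eqxx ltnn /= => m1.
have m0 : m i i != 0.
  apply/negP => /eqP m0; move: m1; rewrite m0 sub0r => /pow_pN.
  by rewrite opprK inE oner_eq0 val1.
split=> //; apply/eqP; rewrite eq_le; apply/andP; split; last first.
  have : m i i \in pow_p 0.
    rewrite -(subrK 1 (m i i)); apply: pow_pD; first exact: pow_p_le m1.
    by rewrite inE val1 lexx orbT.
  by rewrite inE (negPf m0).
rewrite leNgt; apply/negP => vm.
suff : (1 : F) \in pow_p 1 by rewrite inE oner_eq0 val1.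
rewrite -(subKr (m i i) 1); apply: pow_pD; last first.
  exact: pow_pN.
by rewrite inE -gtz0_ge1 vm orbT.
Qed.

(* H = Z K', the center Z consisting of the scalar matrices. *)
Definition H : set M4 :=
  [set h | exists z k, [/\ z != 0, Kprime k & h = z *: k]].

Definition paramodular_exponent (n : nat) (i j : 'I_4) : int :=
  nth 0 (nth [::]
    [:: [:: 0;    0;    0;    - n%:Z];
        [:: n%:Z; 0;    0;    0];
        [:: n%:Z; 0;    0;    0];
        [:: n%:Z; n%:Z; n%:Z; 0] ] i) j.

Definition paramodular (n : nat) : set M4 :=
  [set k | [/\ GSp4 k,
    forall i j, k i j \in pow_p (paramodular_exponent n i j)
    & o_unit (\det k)]].

Definition g_chi (varpi t : F) : M4 := mx4
  [:: [:: 0;             0;         1; 0];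
      [:: 0;             0;         0; -1];
      [:: - (varpi / t); 0;         0; 0];
      [:: 0;             varpi / t; 0; 0] ].

Lemma g_chi_unit varpi t : varpi != 0 -> t != 0 -> g_chi varpi t \in unitmx.
Proof.
move=> w0 t0; have a0 : varpi / t != 0 by rewrite mulf_neq0 // invr_eq0.
have [//] : g_chi varpi t \in unitmx /\ - (varpi / t)^-1 *: g_chi varpi t \in unitmx.
apply: mulmx1_unit; apply/matrixP => i j.
rewrite -scalemxAr !mxE !big_ord_recr big_ord0 /= !mxE.
case: i => -[|[|[|[|//]]]] ?; case: j => -[|[|[|[|//]]]] ? /=;
  rewrite ?(mul0r, mulr0, mul1r, mulr1, add0r, addr0, oppr0) ?eqxx //=;
  by field; rewrite w0 t0.
Qed.

(* H and g_chi H are disjoint. *)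
Lemma g_chi_disjoint varpi t h : H h -> ~ H (g_chi varpi t *m h).
Proof.
move=> [z [k [z0 Kk ->]]] [z' [k' [z'0 Kk' e]]].
have e0 (j : 'I_4) : z * k (inord 2) j = z' * k' 0 j.
  move/matrixP/(_ 0 j): e; rewrite !mxE !big_ord_recr big_ord0 /= !mxE /=.
  rewrite !(mul0r, add0r, addr0, mul1r) => <-; congr (_ * k _ _).
  by apply: val_inj; rewrite /= inordK.
have [k22 v22] := Kprime_diag (inord 2) Kk.
have [k00 v00] := Kprime_diag 0 Kk'.
have k20 : k (inord 2) 0 != 0.
  by apply: contra_neq (mulf_neq0 z'0 k00) => h0; rewrite -e0 h0 mulr0.
have k02 : k' 0 (inord 2) != 0.
  by apply: contra_neq (mulf_neq0 z0 k22) => h0; rewrite e0 h0 mulr0.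
have [_ /(_ (inord 2) 0)] := Kk; rewrite -val_eqE /= !inordK //= subr0.
rewrite inE (negPf k20) /= => v20.
have [_ /(_ 0 (inord 2))] := Kk'; rewrite -val_eqE /= !inordK //= subr0.
rewrite inE (negPf k02) /= => v02.
have := congr1 (@valuation F) (e0 0); rewrite !valM // v00 addr0 => e1.
have := congr1 (@valuation F) (e0 (inord 2)); rewrite !valM // v22 addr0 -e1.
move/eqP; rewrite -addrA -subr_eq0 opprD addNKr oppr_eq0 => /eqP e2.
by have := lerD v20 v02; rewrite e2.
Qed.

Definition Hprime (varpi t : F) : set M4 :=
  H `|` [set g_chi varpi t *m h | h in H].

Section Representations.
Variable R : realType.
Local Notation C := R[i].

(* Continuity of [psi] is not required here: it follows from the
   triviality on o assumed below. *)
Definition additive_character (psi : F -> C) :=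
  psi 0 = 1 /\ forall x y, psi (x + y) = psi x * psi y.

Definition trivial_exactly_on_o (psi : F -> C) :=
  (forall x, x \in pow_p 0 -> psi x = 1) /\
  (exists2 x, x \in pow_p (-1) & psi x != 1).

Definition psi0 (psi : F -> C) (varpi x : F) : C := psi (varpi^-1 * x).

(* The value of chi_{1,1,t} at an element k of K'; indices start at 0. *)
Definition chi_Kprime (psi : F -> C) (varpi t : F) (k : M4) : C :=
  psi0 psi varpi (k`[0, 1] + k`[1, 2] + t * varpi^-1 * k`[3, 0]).

(* chi(z k) = chi_Kprime k; this does not depend on the decomposition of the
   argument, see [chiE] below. *)
Definition chi (psi : F -> C) (varpi t : F) (h : M4) : C :=
  xget 0 [set c | exists z k,
    [/\ z != 0, Kprime k, h = z *: k & c = chi_Kprime psi varpi t k]].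

Lemma chiE psi varpi t z k :
  additive_character psi -> trivial_exactly_on_o psi ->
  uniformizer varpi -> o_unit t -> z != 0 -> Kprime k ->
  chi psi varpi t (z *: k) = chi_Kprime psi varpi t k.
Proof.
move=> [_ psiD] [psi_o _] /andP[w0 /eqP vw] /andP[t0 /eqP vt] z0 Kk.
apply: xget_unique; first by exists z, k.
move=> c [z' [k' [z'0 Kk' ezk ->]]].
have vwV : valuation varpi^-1 = -1.
  have := valM w0 (invr_neq0 w0); rewrite divff // val1 vw => e.
  by apply/eqP; rewrite -subr_eq0 opprK addrC -e.
set u := z^-1 * z'.
have ek : k = u *: k' by rewrite -scalerA -ezk scalerA mulVf // scale1r.
have u0 : u != 0 by rewrite mulf_neq0 // invr_eq0.
have [k0 vk] := Kprime_diag 0 Kk; have [k'0 vk'] := Kprime_diag 0 Kk'.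
have ek0 : k 0 0 = u * k' 0 0 by rewrite {1}ek mxE.
have vu : valuation u = 0 by move: vk; rewrite ek0 valM // vk' addr0.
have u1 : u - 1 \in pow_p 1.
  have -> : u - 1 = (k 0 0 - 1) - u * (k' 0 0 - 1) by rewrite ek0; ring.
  apply: pow_pD; first by have [_ /(_ 0 0)] := Kk.
  apply: pow_pN; rewrite -[X in pow_p X]add0r; apply: pow_pM.
    by rewrite inE vu lexx orbT.
  by have [_ /(_ 0 0)] := Kk'.
rewrite /chi_Kprime /psi0.
set a := fun m : M4 => m`[0, 1] + m`[1, 2] + t * varpi^-1 * m`[3, 0].
rewrite -/(a k) -/(a k').
have -> : a k = a k' + (u - 1) * a k' by rewrite /a ek !mxE; ring.
rewrite (mulrDr varpi^-1 (a k')) psiD (psi_o (_ * (_ * _))) ?mulr1 //.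
rewrite -[X in pow_p X](addNr 1); apply: pow_pM.
  by rewrite inE vwV lexx orbT.
rewrite -[X in pow_p X]addr0; apply: pow_pM => //.
have entry i j : k' i j - (i == j)%:R \in
  pow_p (if (i < j)%N then 0 else 1) by have [_ /(_ i j)] := Kk'.
apply: pow_pD; first apply: pow_pD.
- by have := entry (inord 0) (inord 1); rewrite -val_eqE /= !inordK //= subr0.
- by have := entry (inord 1) (inord 2); rewrite -val_eqE /= !inordK //= subr0.
rewrite -[X in pow_p X](addNr 1); apply: pow_pM.
  by rewrite inE valM ?invr_eq0 // vt vwV lexx orbT.
by have := entry (inord 3) (inord 0); rewrite -val_eqE /= !inordK //= subr0.
Qed.

(* The extension of chi to H' with chi(g_chi h) = eps chi(h), see
   [chi_pmE] below. *)
Definition chi_pm (psi : F -> C) (varpi t : F) (eps : C) (h : M4) : C :=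
  if `[< H h >] then chi psi varpi t h
  else eps * chi psi varpi t (invmx (g_chi varpi t) *m h).

Lemma chi_pmE psi varpi t eps h : varpi != 0 -> t != 0 -> H h ->
  chi_pm psi varpi t eps h = chi psi varpi t h /\
  chi_pm psi varpi t eps (g_chi varpi t *m h) = eps * chi psi varpi t h.
Proof.
move=> w0 t0 Hh; rewrite /chi_pm; split; first by case: asboolP.
case: asboolP => [/(g_chi_disjoint Hh)//|_].
by rewrite mulKmx // g_chi_unit.
Qed.

(* c-Ind from a subgroup S of GSp4 of a character [lambda] of S.  Its vectors
   are functions on GSp4, here extended by zero to all matrices; GSp4 acts
   on them by right translation. *)
Definition right_translation (k : M4) (f : M4 -> C) : M4 -> C :=
  fun g => f (g *m k).

Definition smooth (f : M4 -> C) :=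
  \forall k \near (1%:M : M4), GSp4 k -> right_translation k f = f.

Definition compact_support_mod (S : set M4) (f : M4 -> C) :=
  exists K : set M4, [/\ compact K, K `<=` GSp4 &
    forall g, f g != 0 -> exists s k, [/\ S s, K k & g = s *m k]].

Definition cInd (S : set M4) (lambda : M4 -> C) : set (M4 -> C) :=
  [set f | [/\ forall g, ~ GSp4 g -> f g = 0,
               forall s g, S s -> GSp4 g -> f (s *m g) = lambda s * f g,
               smooth f
             & compact_support_mod S f]].

Definition has_fixed_vector (V : set (M4 -> C)) (K : set M4) :=
  exists f, [/\ V f, f <> (fun=> 0) &
    forall k, K k -> right_translation k f = f].

(* The conductor exponent of a representation realized on a space V of
   functions on GSp4 under right translation. *)
Definition conductor_exponent_is (V : set (M4 -> C)) (a : nat) :=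
  has_fixed_vector V (paramodular a) /\
  forall n, has_fixed_vector V (paramodular n) -> (a <= n)%N.

Definition sigma_chi (psi : F -> C) (varpi t : F) (eps : C) : set (M4 -> C) :=
  cInd (Hprime varpi t) (chi_pm psi varpi t eps).

End Representations.
End GSp4.

(* Main.v *)
(* Lower bound.  If f is fixed by K(p^n) and f(g) <> 0, then chi is trivial on
   K' `&` g K(p^n) g^-1.  The Iwahori lattice chain gives every nonzero vector
   a level: e_0, .., e_3 have levels 0, .., 3, and multiplication by varpi
   lowers the level by 4.  Let N(a,b) = p^a L1 + p^b L2, where L1 and L2 are
   lattices in the orthogonal planes spanned by g e_0, g e_3 and by g e_1,
   g e_2.  Vectors of levels 1 and 3 in suitable N(a,b) define transvections,
   and pairs of vectors of levels 0 and 2 define elements of short root type,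
   that lie in K' `&` g K(p^n) g^-1 and on which chi is nontrivial.  So these
   levels are forbidden.  Since N(a,b) has a level i exactly when its
   symplectic dual, again of the form N(a',b'), misses the level 7 - i, each
   forbidden level forces another level to occur; for n <= 4 this is
   contradictory, by pure combinatorics.

   Level 5.  For g = diag(varpi^3, varpi^2, varpi, 1), the elements of
   g K(p^5) g^-1 have the entries that enter chi in p, p and p^2, and unit
   similitude factor; so chi^+ and chi^- are trivial on H' `&` g K(p^5) g^-1,
   and both extend to a fixed vector supported on H' g K(p^5). *)

Require Import Defs.
From mathcomp Require Import all_boot all_order all_algebra.
From mathcomp Require Import all_classical all_reals topology.
From mathcomp Require Import complex zify ring.

Set Implicit Arguments.
Unset Strict Implicit.
Unset Printing Implicit Defensive.

Import Order.TTheory GRing.Theory Num.Theory.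
Local Open Scope ring_scope.

(** * Combinatorics of levels *)

(* [H a b i] is to be read as: N(a,b) contains a vector of level i.  The level
   of K(p^n) is n = 2 k + e. *)
Section LevelCombinatorics.
Variables (H : int -> int -> int -> Prop) (e k : int).
Hypothesis e01 : 0 <= e <= 1.
Hypothesis ke : k <= 2 - e.
Hypothesis mono : forall a b a' b' i, a' <= a -> b' <= b -> H a b i -> H a' b' i.
Hypothesis shift : forall a b i, H a b i <-> H (a + 1) (b + 1) (i - 4).
Hypothesis dual : forall a b i, H a b i <-> ~ H (- a - e) (- b) (7 - i).
Hypothesis sum : forall a b a' b' i, a' <= a -> b <= b' -> H a' b i ->
  [\/ H a b i, H a' b' i | exists j, [/\ i < j, H a b j & H a' b' j]].
Hypothesis no_level1 : forall a b,
  0 <= 2 * a + e -> 0 <= b -> k <= a + b -> ~ H a b 1.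
Hypothesis no_level3 : forall a b,
  0 <= 2 * a + e + 1 -> 0 <= 2 * b + 1 -> k <= a + b + 1 -> ~ H a b 3.
Hypothesis no_level02 : forall a b a' b', 0 <= a + a' + e -> 0 <= b + b' ->
  k <= a + b' -> k <= a' + b -> H a b 0 -> ~ H a' b' 2.

Lemma level_sub4 a b i : H a b i -> H a b (i - 4).
Proof. by move=> /shift; apply: mono; lia. Qed.

(** Multiplication by the uniformizer lowers levels by 4, so a higher level would descend to one of
    the four consecutive missing ones. *)
Lemma level_above a b i :
  ~ H a b i -> ~ H a b (i + 1) -> ~ H a b (i + 2) -> ~ H a b (i + 3) ->
  forall j, i <= j -> ~ H a b j.
Proof.
move=> h0 h1 h2 h3 j ij; have -> : j = i + (absz (j - i)) by lia.
elim/ltn_ind: (absz _) => -[|[|[|[|n]]]] IH; rewrite ?addr0 //.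
move=> /level_sub4; have -> : i + n.+4 - 4 = i + n by lia.
by apply: IH; lia.
Qed.

Lemma level_shift a b i : H a b (i + 4) -> H (a + 1) (b + 1) i.
Proof. by move=> /shift; rewrite addrK. Qed.

Lemma dual_level a b i a' b' i' :
  a' = - a - e -> b' = - b -> i' = 7 - i -> ~ H a b i -> H a' b' i'.
Proof. by move=> -> -> -> /(contra_notP (proj2 (dual _ _ _))). Qed.

Lemma dual_nlevel a b i a' b' i' :
  a' = - a - e -> b' = - b -> i' = 7 - i -> H a b i -> ~ H a' b' i'.
Proof. by move=> -> -> -> /dual. Qed.

(** Here k <= 1. Level 0 of N(0,1) excludes level 2 there, which dualizes to level 1 of N(0,0). As
    N(0,1) has no positive level, splitting that level 1 vector along N(1,0) and N(0,1) is
    impossible. *)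
Lemma levels_absurd_odd : e = 1 -> False.
Proof.
move=> e1.
have H010 : H 0 1 0.
  apply/(@level_shift (-1) 0)/(@dual_level 0 0 3); rewrite ?e1 //.
  by apply: no_level3; lia.
have N012 : ~ H 0 1 2 by apply: no_level02 H010; lia.
have H001 : H 0 0 1.
  by apply/(@level_shift (-1) (-1))/(@dual_level 0 1 2); rewrite ?e1.
have N003 : ~ H 0 0 3 by apply: no_level3; lia.
have N011 : ~ H 0 1 1 by apply: no_level1; lia.
have N004 : ~ H 0 0 4.
  move=> /(@level_shift _ _ 0) H110; apply: N011.
  apply/(@level_shift (-1) 0)/(@dual_level 0 0 2); rewrite ?e1 //.
  by apply: no_level02 H110; lia.
have N01 j : 1 <= j -> ~ H 0 1 j.
  by apply: level_above => // /mono h; [apply: N003|apply: N004]; apply: h.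
have [||[j [lj _ /N01]]] := @sum 1 0 0 1 1 isT isT H001; last by apply; lia.
  by apply: no_level1; lia.
by [].
Qed.

(** Here k <= 2. Level 4 turns out to be the highest level of N(0,0). Splitting a vector of level 4
    along N(1,0) and N(0,1) puts level 4 in one of them; either case yields a level 1 vector, and
    splitting that one gives only forbidden levels. *)
Lemma levels_absurd_even : e = 0 -> False.
Proof.
move=> e0.
have N1 a b : 0 <= a -> 0 <= b -> 2 <= a + b -> ~ H a b 1.
  by move=> *; apply: no_level1; lia.
(* Level 0 of N(a,b) forbids level 2 of N(2-b,2-a); dualizing and multiplying by the uniformizer
   gives level 1 of N(b-1,a-1). *)
have sh a b : a - b <= 2 -> b - a <= 2 -> H a b 0 -> H (b - 1) (a - 1) 1.
  move=> ab ba Hab; have -> : b - 1 = b - 2 + 1 by lia.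
  have -> : a - 1 = a - 2 + 1 by lia.
  apply/level_shift/(@dual_level (2 - b) (2 - a) 2); try lia.
  by apply: no_level02 Hab; lia.
have H100 : H 1 0 0.
  apply/(@level_shift 0 (-1))/(@dual_level 0 1 3); rewrite ?e0 //.
  by apply: no_level3; lia.
have N005 : ~ H 0 0 5 by move=> /(@level_shift _ _ 1); apply: N1.
have H004 : H 0 0 4.
  apply: contrapT => N004.
  (* N(0,0) is self-dual when e = 0, so missing level 4 means having level 3. *)
  have H003 : H 0 0 3 by apply: (@dual_level 0 0 4); rewrite ?e0.
  have N10 j : 3 <= j -> ~ H 1 0 j.
    apply: level_above; first by apply: no_level3; lia.
    - by move=> /mono h; apply/N004/h.
    - by move=> /mono h; apply/N005/h.
    apply: (@dual_nlevel (-1) 0 1); rewrite ?e0 //.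
    by apply: (sh 1 0).
  have [/N10|/no_level3|[j [lj /N10]]] := @sum 1 0 0 1 3 isT isT H003;
    try (by apply; lia).
  by lia.
have H110 : H 1 1 0 by apply: (@level_shift 0 0 0).
have N00 j : 5 <= j -> ~ H 0 0 j.
  apply: level_above => //.
  - by apply: (@dual_nlevel 0 0 1); rewrite ?e0 //; apply: (sh 1 1).
  - apply: (@dual_nlevel 0 0 0); rewrite ?e0 //.
    by have := level_sub4 H004.
  move=> /(@level_shift _ _ 4)/(@level_shift _ _ 0)/sh.
  by move=> /(_ isT isT); apply: N1.
have N11 j : 1 < j -> ~ H 1 1 j.
  move=> lj H11j; apply: (N00 (j + 4)); first by lia.
  by apply/shift; rewrite addrK.
have [||[j [lj _ H01j]]] := @sum 1 0 0 1 4 isT isT H004; last first.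
  by apply: (N00 j); [lia|exact: (@mono 0 1)].
- move=> /(@level_shift _ _ 0)/sh => /(_ isT isT) H101.
  by have [||[j [lj _ /N11]]] := @sum 2 0 1 1 1 isT isT H101; [apply: N1..|].
- move=> /(@level_shift _ _ 0)/sh => /(_ isT isT) H011.
  by have [||[j [lj /N11 h _]]] := @sum 1 1 0 2 1 isT isT H011; [apply: N1..|].
Qed.

Lemma levels_absurd : False.
Proof.
have [/levels_absurd_even//|/levels_absurd_odd//] : e = 0 \/ e = 1 by lia.
Qed.
End LevelCombinatorics.

(** * Valuations and levels *)

Section Valuation.
Variable F : localFieldType.
Implicit Types (x y : F) (m n : int).

Definition valeq m x := (x != 0) && (valuation x == m).

Lemma valeq_neq0 m x : valeq m x -> x != 0.
Proof. by case/andP. Qed.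

Lemma valeq_valuation x : x != 0 -> valeq (valuation x) x.
Proof. by rewrite /valeq eqxx andbT. Qed.

Lemma valeqM m n x y : valeq m x -> valeq n y -> valeq (m + n) (x * y).
Proof.
move=> /andP[x0 /eqP <-] /andP[y0 /eqP <-].
by rewrite /valeq mulf_neq0 //= Defs.valM.
Qed.

Lemma valeqN m x : valeq m (- x) = valeq m x.
Proof. by rewrite /valeq oppr_eq0; case: eqP => //= /eqP x0; rewrite Defs.valN. Qed.

Lemma valeq1 : valeq 0 (1 : F).
Proof. by rewrite /valeq oner_neq0 Defs.val1 eqxx. Qed.

Lemma valeqV m x : valeq m x -> valeq (- m) x^-1.
Proof.
move=> /andP[x0 /eqP <-]; rewrite /valeq invr_eq0 x0 /=.
have := Defs.valM x0 (invr_neq0 x0); rewrite divff // Defs.val1.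
by move/eqP; rewrite eq_sym addrC addr_eq0.
Qed.

Lemma valeqX m (n : nat) x : valeq m x -> valeq (m * n%:Z) (x ^+ n).
Proof.
move=> xm; elim: n => [|n IH]; first by rewrite mulr0 valeq1.
by rewrite exprS -addn1 PoszD mulrDr addrC mulr1 valeqM.
Qed.

Lemma valeqXz m n x : valeq m x -> valeq (m * n) (x ^ n).
Proof.
move=> xm; case: n => p; first exact: valeqX.
by rewrite NegzE mulrN; apply: valeqV; apply: valeqX.
Qed.

Lemma valeq_mem m n x : valeq m x -> (x \in pow_p n) = (n <= m).
Proof. by move=> /andP[x0 /eqP <-]; rewrite inE (negPf x0). Qed.

Lemma valeq_pow_p m x : valeq m x -> x \in pow_p m.
Proof. by move=> xm; rewrite (valeq_mem _ xm). Qed.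

Lemma valeqE m x : valeq m x = (x \in pow_p m) && (x \notin pow_p (m + 1)).
Proof.
rewrite /valeq !inE; case: eqVneq => //= _.
by apply/idP/idP; lia.
Qed.

Lemma valeqDl m x y : valeq m x -> y \in pow_p (m + 1) -> valeq m (x + y).
Proof.
rewrite !valeqE => /andP[xm xm1] ym1; apply/andP; split.
  by apply: pow_pD => //; apply: pow_p_le ym1; lia.
by apply: contra xm1 => /(pow_pD)/(_ (pow_pN ym1)); rewrite addrK.
Qed.

Lemma pow_pM_le a b n x y :
  n <= a + b -> x \in pow_p a -> y \in pow_p b -> x * y \in pow_p n.
Proof. by move=> nab xa yb; apply: pow_p_le nab (pow_pM xa yb). Qed.

Lemma pow_pB n x y : x \in pow_p n -> y \in pow_p n -> x - y \in pow_p n.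
Proof. by move=> xn /pow_pN; apply: pow_pD. Qed.

Lemma pow_pZ m n x y : valeq m x -> (x * y \in pow_p n) = (y \in pow_p (n - m)).
Proof.
move=> xm; apply/idP/idP; last first.
  by apply: pow_pM_le (valeq_pow_p xm); lia.
move=> xy; rewrite -[y](mulKf (valeq_neq0 xm)).
by apply: pow_pM_le xy; last exact: valeq_pow_p (valeqV xm); lia.
Qed.

Lemma pow_p_sum (I : Type) (r : seq I) n (f : I -> F) :
  (forall i, f i \in pow_p n) -> \sum_(i <- r) f i \in pow_p n.
Proof. by move=> h; elim/big_ind: _ => [||//]; [exact: pow_p0|exact: pow_pD]. Qed.

End Valuation.

Definition o0 : 'I_4 := @Ordinal 4 0 isT.
Definition o1 : 'I_4 := @Ordinal 4 1 isT.
Definition o2 : 'I_4 := @Ordinal 4 2 isT.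
Definition o3 : 'I_4 := @Ordinal 4 3 isT.

Lemma ord4_ind (P : 'I_4 -> Prop) : P o0 -> P o1 -> P o2 -> P o3 -> forall i, P i.
Proof.
move=> p0 p1 p2 p3 [[|[|[|[|//]]]] ilt];
  [move: p0|move: p1|move: p2|move: p3]; congr P; exact: val_inj.
Qed.

Lemma sum_ord4 (V : nmodType) (f : 'I_4 -> V) :
  \sum_i f i = f o0 + f o1 + f o2 + f o3.
Proof.
rewrite !big_ord_recr big_ord0 /= add0r.
by do !congr (_ + _); congr f; apply: val_inj.
Qed.

Lemma inord4E : (inord 0 = o0) * (inord 1 = o1) * (inord 2 = o2) * (inord 3 = o3).
Proof. by do !split; apply: val_inj; rewrite /= inordK. Qed.

(** * Levels of vectors and their behaviour under the symplectic form *)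

Section Levels.
Variable F : localFieldType.
Implicit Types (v w : 'cV[F]_4) (l m : int).
Local Notation J := (J F).

(* The level of v is the maximum of i - 4 val(v_i), which is attained at a
   single i since the terms are distinct modulo 4; [levle l v] says that it is
   at most l, and holds for all l when v = 0. *)
Definition levle l v :=
  forall i : 'I_4, v i 0 \in pow_p (- ((l - i%:Z) %/ 4)%Z).

Definition lev_at l v := levle l v /\ ~ levle (l - 1) v.

Lemma levle_mono l m v : l <= m -> levle l v -> levle m v.
Proof. by move=> lm lv i; apply: pow_p_le (lv i); lia. Qed.

Lemma levle0 l : levle l 0.
Proof. by move=> i; rewrite mxE pow_p0. Qed.

Lemma levleD l v w : levle l v -> levle l w -> levle l (v + w).
Proof. by move=> lv lw i; rewrite mxE pow_pD. Qed.

Lemma levleN l v : levle l v -> levle l (- v).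
Proof. by move=> lv i; rewrite mxE pow_pN. Qed.

Lemma levleB l v w : levle l v -> levle l w -> levle l (v - w).
Proof. by move=> lv lw; apply: levleD => //; apply: levleN. Qed.

Lemma levleZ n c l v : c \in pow_p n -> levle l v -> levle (l - 4 * n) (c *: v).
Proof. by move=> cn lv i; rewrite mxE; apply: pow_pM_le (lv i) => //; lia. Qed.

Lemma levleZE n c l v :
  valeq n c -> levle (l - 4 * n) (c *: v) <-> levle l v.
Proof.
move=> cn; split; last exact/levleZ/valeq_pow_p.
move=> /(levleZ (valeq_pow_p (valeqV cn))).
rewrite scalerA mulVf ?(valeq_neq0 cn) // scale1r.
by apply: levle_mono; lia.
Qed.

Lemma lev_atZ n c l v :
  valeq n c -> lev_at (l - 4 * n) (c *: v) <-> lev_at l v.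
Proof.
move=> cn; rewrite /lev_at; have -> : l - 4 * n - 1 = l - 1 - 4 * n by lia.
by rewrite !(levleZE _ _ cn).
Qed.

(** Some coordinate violates the bound for l - 1 but meets the one for l. The two floors differ only
    when 4 divides l - i, and this fixes the valuation. *)
Lemma lev_at_lead l v : lev_at l v -> exists i : 'I_4, exists2 m,
  valeq m (v i 0) & l = i%:Z - 4 * m.
Proof.
move=> [lv nlv]; have [i vi] : exists i : 'I_4,
    v i 0 \notin pow_p (- ((l - 1 - i%:Z) %/ 4)%Z).
  by apply: contrapT => h; apply: nlv => i; apply: contrapT => /negP vi; apply: h; exists i.
exists i; move: vi (lv i); rewrite inE negb_or -ltNge => /andP[vi0 vi].
rewrite inE (negPf vi0) /= => vi'.
exists (valuation (v i 0)); first exact: valeq_valuation.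
by lia.
Qed.

Lemma lev_at_of_lead l v (i : 'I_4) m :
  levle l v -> valeq m (v i 0) -> l = i%:Z - 4 * m -> lev_at l v.
Proof.
move=> lv vi il; split=> // /(_ i); rewrite (valeq_mem _ vi); lia.
Qed.

Lemma lev_at_neq0 l v : lev_at l v -> v != 0.
Proof. by move=> [_]; apply: contra_notN => /eqP ->; exact: levle0. Qed.

Lemma levle_exists v : exists l, levle l v.
Proof.
have [n vn] : exists n, forall i, v i 0 \in pow_p n.
  exists (Num.min (Num.min (valuation (v o0 0)) (valuation (v o1 0)))
              (Num.min (valuation (v o2 0)) (valuation (v o3 0)))).
  elim/ord4_ind; rewrite inE !ge_min lexx ?orbT //.
(* With this level the required exponent is exactly n at each of the indices 0, .., 3. *)
exists (3 - 4 * n) => i; apply: pow_p_le (vn i).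
by case: i => i /=; lia.
Qed.

Lemma levle_of_nlev l v : (forall j, l < j -> ~ lev_at j v) -> levle l v.
Proof.
move=> h; have [m vm] := levle_exists v.
have [ml|lm] := leP m l; first exact: levle_mono vm.
have {vm lm} : levle (l + (absz (m - l))) v by move: vm; congr levle; lia.
elim: (absz _) => [|n IH vn]; first by rewrite addr0.
apply: IH; apply: contrapT => nvn; apply: (h (l + n.+1)); first by lia.
by split=> //; have -> : l + n.+1 - 1 = l + n by lia.
Qed.

Lemma lev_at_exists v : v != 0 -> exists l, lev_at l v.
Proof.
move=> v0; apply: contrapT => h.
have all_le l : levle l v by apply: levle_of_nlev => j _ vj; apply: h; exists j.
move/eqP: v0; apply; apply/matrixP => i j; rewrite ord1 mxE; apply/eqP.
apply: contrapT => /negP vi0.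
have := all_le (i%:Z - 4 * (valuation (v i 0) + 1)) i.
rewrite inE (negPf vi0) /=; lia.
Qed.

Lemma lev_atD l v w : lev_at l v -> levle (l - 1) w -> lev_at l (v + w).
Proof.
move=> [lv nlv] lw; split.
  by apply: levleD => //; apply: levle_mono lw; lia.
by move=> /levleB/(_ lw); rewrite addrK.
Qed.

Lemma lev_at_inj l m v : lev_at l v -> lev_at m v -> l = m.
Proof.
move=> [lv nlv] [mv nmv]; apply/eqP; rewrite eq_le; apply/andP; split; rewrite leNgt.
  by apply/negP => ml; apply: nlv; apply: levle_mono mv; lia.
by apply/negP => ml; apply: nmv; apply: levle_mono lv; lia.
Qed.

Definition form v w : F := (v^T *m J *m w) 0 0.

Lemma JE (i j : 'I_4) : J i j =
  if (i + j == 3)%N then (if (i < 2)%N then 1 else -1) else 0.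
Proof. by rewrite mxE; move: i j; do 2!elim/ord4_ind. Qed.

Lemma trJE v (j : 'I_4) :
  (v^T *m J) 0 j = (if (j < 2)%N then -1 else 1) * v (rev_ord j) 0.
Proof.
rewrite mxE sum_ord4 !JE !mxE; move: j; elim/ord4_ind => /=;
  rewrite !(mulr0, addr0, add0r, mulr1, mul1r, mulrN, mulN1r) //;
  by do ?congr (- _); congr (v _ _); apply: val_inj.
Qed.

Lemma form_sum v w : form v w =
  \sum_(i < 4) (if (i < 2)%N then 1 else -1) * (v i 0 * w (rev_ord i) 0).
Proof.
rewrite /form mxE (reindex_inj rev_ord_inj) /=; apply: eq_bigr => i _.
rewrite trJE rev_ordK /= mulrA; congr (_ * _ * _).
by move: i; elim/ord4_ind.
Qed.

(** Paired indices sum to 3, so each product has valuation at least -floor((l + m - 3)/4), which is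
    at least n. *)
Lemma form_levle l m n v w :
  levle l v -> levle m w -> l + m <= 6 - 4 * n -> form v w \in pow_p n.
Proof.
move=> lv mw lm; rewrite form_sum; apply: pow_p_sum => i.
have vw : v i 0 * w (rev_ord i) 0 \in pow_p n.
  by apply: pow_pM_le (lv i) (mw _) => /=; have := ltn_ord i; lia.
by case: ifP; rewrite ?mul1r ?mulN1r ?pow_pN.
Qed.

(* The leading coordinates of v and w are paired with each other. *)
Lemma form_lev_at l m n v w :
  lev_at l v -> lev_at m w -> l + m = 3 - 4 * n -> valeq n (form v w).
Proof.
move=> lv mw lmn; have [i [a va la]] := lev_at_lead lv.
have [j [b wb mb]] := lev_at_lead mw; case: lv mw => lv _ [mw _].
have ab := valeqM va wb.
have j3 : j = rev_ord i by apply: val_inj => /=; have := ltn_ord j; have := ltn_ord i; lia.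
have nab : n = a + b by move: lmn; rewrite la mb j3 /=; have := ltn_ord i; lia.
have small k : k != i -> v k 0 * w (rev_ord k) 0 \in pow_p (n + 1).
  move=> ki; have ki' : (k : nat) != i by [].
  apply: pow_pM_le (lv k) (mw _) => /=; have := ltn_ord k; have := ltn_ord i; lia.
rewrite form_sum (bigD1 i) //=; apply: valeqDl.
  by rewrite -j3 nab; case: ifP; rewrite ?mul1r ?mulN1r ?valeqN.
elim/big_ind: _ => [||k ki]; [exact: pow_p0|exact: pow_pD|].
by case: ifP; rewrite ?mul1r ?mulN1r ?pow_pN ?small.
Qed.

End Levels.

(** * Levels of dual lattices *)

Section LatticeDuality.
Variables (F : localFieldType) (varpi : F).
Hypothesis varpi_unif : uniformizer varpi.
Implicit Types (x y v : 'cV[F]_4) (l : int).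
Local Notation J := (J F).

Lemma valeq_varpi n : valeq n (varpi ^ n).
Proof. by rewrite -[X in valeq X]mul1r; apply: valeqXz. Qed.

(** Levels are ultrametric: among distinct levels, the highest one survives in the sum. *)
Lemma lev_at_sum (f : 'I_4 -> 'cV[F]_4) (l : 'I_4 -> int) (r : seq 'I_4) :
  injective l -> uniq r -> r != [::] -> (forall d, d \in r -> lev_at (l d) (f d)) ->
  exists2 d, d \in r & lev_at (l d) (\sum_(d <- r) f d).
Proof.
move=> l_inj; elim: r => // d [|d' r] IH /andP[dr ur] _ lf.
  exists d; first by rewrite mem_head.
  by rewrite big_seq1; apply/lf/mem_head.
have [//|//||d'' d''r ld''] := IH.
  by move=> d1 d1r; apply: lf; rewrite inE d1r orbT.
rewrite big_cons; have ld := lf d (mem_head _ _).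
have ldd'' : l d <> l d'' by move=> /l_inj dd; rewrite dd d''r in dr.
have [lt|ge] := ltP (l d) (l d'').
  exists d''; first by rewrite inE d''r orbT.
  rewrite addrC; apply: lev_atD => //.
  by apply: levle_mono (proj1 ld); lia.
exists d; first exact: mem_head.
by apply: lev_atD => //; apply: levle_mono (proj1 ld''); lia.
Qed.

Definition integral x := forall i, x i 0 \in pow_p 0.

Lemma integralZ c x : c \in pow_p 0 -> integral x -> integral (c *: x).
Proof. by move=> c0 ix i; rewrite mxE; apply: pow_pM_le c0 (ix i). Qed.

Lemma integralD x y : integral x -> integral y -> integral (x + y).
Proof. by move=> ix iy i; rewrite mxE pow_pD. Qed.

Lemma integral_form x y : integral x -> integral y -> form x y \in pow_p 0.
Proof.
move=> ix iy; rewrite form_sum; apply: pow_p_sum => i.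
have xy : x i 0 * y (rev_ord i) 0 \in pow_p 0 by apply: pow_pM_le (ix _) (iy _).
by case: ifP; rewrite ?mul1r ?mulN1r ?pow_pN.
Qed.

Lemma mulmx_sum_col (M : 'M[F]_4) x : M *m x = \sum_j x j 0 *: col j M.
Proof.
apply/matrixP => i j; rewrite ord1 mxE summxE; apply: eq_bigr => k _.
by rewrite !mxE mulrC.
Qed.

Lemma levle_integral_image (M : 'M[F]_4) :
  exists B, forall x, integral x -> levle B (M *m x).
Proof.
have /fin_all_exists[B MB] j : exists l, levle l (col j M) := levle_exists _.
exists (Num.max (Num.max (B o0) (B o1)) (Num.max (B o2) (B o3))) => x ix.
rewrite mulmx_sum_col; elim/big_ind: _ => [||j _].
- exact: levle0.
- exact: levleD.
have /(levleZ (ix j)) := MB j; apply: levle_mono.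
by move: j {ix}; elim/ord4_ind; rewrite !le_max mulr0 subr0 lexx ?orbT.
Qed.

Lemma exists_integral_multiple x : exists N : nat, integral (varpi ^ N *: x).
Proof.
have [l xl] := levle_exists x; exists (absz l) => i.
by rewrite mxE; apply: pow_pM_le (valeq_pow_p (valeq_varpi _)) (xl i); lia.
Qed.

Lemma lev_at_delta (c : 'I_4) : lev_at c (delta_mx c 0 : 'cV[F]_4).
Proof.
apply: (@lev_at_of_lead _ _ _ c 0); last by rewrite mulr0 subr0.
  move=> i; rewrite mxE eqxx andbT; case: eqP => [->|_]; last exact: pow_p0.
  by rewrite subrr (valeq_mem _ (valeq1 F)).
by rewrite mxE !eqxx valeq1.
Qed.

Definition level_of (M : 'M[F]_4) l := exists2 x, integral x & lev_at l (M *m x).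

Lemma level_of_sub4 M l (n : nat) : level_of M l -> level_of M (l - 4 * n%:Z).
Proof.
move=> [x ix lx]; exists (varpi ^ n *: x).
  by apply: integralZ => //; rewrite (valeq_mem _ (valeq_varpi _)).
by rewrite -scalemxAr; apply/lev_atZ => //; apply: valeq_varpi.
Qed.

(** The lattice M o^4 contains a multiple of every vector, so it meets each class modulo 4, and its
    levels are bounded above. A minimal q is a maximal level. *)
Lemma max_level M (c : 'I_4) : M \in unitmx -> exists q,
  level_of M (c%:Z - 4 * q) /\ forall q', level_of M (c%:Z - 4 * q') -> q <= q'.
Proof.
move=> uM; have [N iN] := exists_integral_multiple (invmx M *m delta_mx c 0).
have [B MB] := levle_integral_image M.
(* Counting downwards from N turns the smallest integer q into a largest natural number. *)
pose P (n : nat) := `[< level_of M (c%:Z - 4 * (N%:Z - n%:Z)) >].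
have P0 : exists n, P n.
  exists 0%N; apply/asboolP; exists (varpi ^ N *: (invmx M *m delta_mx c 0)) => //.
  rewrite -scalemxAr mulKVmx // subr0; apply/lev_atZ; first exact: valeq_varpi.
  exact: lev_at_delta.
have PB n : P n -> (n <= absz B + N)%N.
  move=> /asboolP[x ix [_]]; apply: contra_notT => nB.
  by apply: levle_mono (MB x ix); lia.
have [n Pn maxn] := ex_maxnP P0 PB.
exists (N%:Z - n%:Z); split; first exact/asboolP.
move=> q' lq'; rewrite leNgt; apply/negP => q'lt.
have /maxn : P (absz (N%:Z - q')).
  by apply/asboolP; move: lq'; congr level_of; lia.
by lia.
Qed.

Lemma J_unit : J \in unitmx.
Proof.
have [//] : J \in unitmx /\ - J \in unitmx.
apply: mulmx1_unit; apply/matrixP => i j; rewrite !mxE sum_ord4 !mxE.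
move: i j; do 2!elim/ord4_ind; rewrite /=; ring.
Qed.

(* Choose vectors p_c of maximal level in each class c modulo 4.  Maximality
   makes them a basis of the lattice M o^4, and the dual basis vector of p_c,
   which lies in M' o^4, has level 3 - lev p_c. *)
Lemma level_dual M M' mu i : M \in unitmx -> valeq 0 mu ->
  M^T *m J *m M' = mu *: J -> level_of M i <-> ~ level_of M' (7 - i).
Proof.
move=> uM vmu MM'.
have formM x y : form (M *m x) (M' *m y) = mu * form x y.
  rewrite /form trmx_mul -!mulmxA (mulmxA J) (mulmxA M^T) (mulmxA M^T) MM'.
  by rewrite -scalemxAl -scalemxAr mxE !mulmxA.
split.
  (* Vectors of levels i and 7 - i pair to valuation -1, whereas the two lattices pair
     integrally. *)
  move=> [x ix lx] [y iy ly].
  have := form_lev_at (n := -1) lx ly; rewrite formM.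
  have /[swap] /[apply] : i + (7 - i) = 3 - 4 * -1 by lia.
  move=> /valeq_mem -/(_ 0); rewrite (pow_pZ _ _ vmu) subr0.
  by rewrite integral_form.
have uM' : M' \in unitmx.
  have : (mu *: J) \in unitmx by rewrite unitmxZ ?J_unit // unitfE (valeq_neq0 vmu).
  by rewrite -MM' unitmx_mul => /andP[].
have /fin_all_exists[q /all_and2[lq maxq]] (c : 'I_4) := max_level c uM.
have /fin_all_exists2[x ix lx] (c : 'I_4) : exists2 x, integral x &
   lev_at (c%:Z - 4 * q c) (M *m x) := lq c.
pose p c := M *m x c.
pose P := (\matrix_(i, j) p j i 0) : 'M[F]_4.
have PE a : P *m a = \sum_d a d 0 *: p d.
  rewrite mulmx_sum_col; apply: eq_bigr => d _; congr (_ *: _).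
  by apply/matrixP => i' j'; rewrite ord1 !mxE.
have inj_lev (m : 'I_4 -> int) : injective (fun d : 'I_4 => d%:Z - 4 * m d).
  move=> d d' /= e; apply: val_inj => /=.
  by have := ltn_ord d; have := ltn_ord d'; lia.
(* Scalars move levels by multiples of 4, so the terms of a combination stay in distinct classes
   modulo 4 and cannot cancel. *)
have lev_comb (a : 'cV[F]_4) (D : pred 'I_4) d0 : D d0 -> (forall d, D d -> a d 0 != 0) ->
  exists2 d, D d & lev_at (d%:Z - 4 * (q d + valuation (a d 0))) (\sum_(d | D d) a d 0 *: p d).
  move=> Dd0 aD; rewrite -big_filter; set r := [seq _ <- _ | _].
  have [||d|d] := @lev_at_sum (fun d => a d 0 *: p d)
    (fun d => d%:Z - 4 * (q d + valuation (a d 0))) r (@inj_lev _).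
  - by rewrite filter_uniq // index_enum_uniq.
  - by apply: contraTneq Dd0 => r0; rewrite -[D d0]andbT -(mem_index_enum d0) -mem_filter -/r r0.
  - rewrite mem_filter => /andP[Dd _].
    have -> : d%:Z - 4 * (q d + valuation (a d 0)) =
      d%:Z - 4 * q d - 4 * valuation (a d 0) by lia.
    by apply/lev_atZ => //; apply/valeq_valuation/aD.
  by rewrite mem_filter => /andP[Dd _] ld; exists d.
have uP : P \in unitmx.
  rewrite -unitmx_tr unitmxE unitfE; apply/det0P => -[a a0].
  move=> /(congr1 trmx); rewrite trmx0 trmx_mul trmxK PE.
  have [d0 ad0] : exists d, a^T d 0 != 0.
    apply: contrapT => h; move/eqP: a0; apply; apply/matrixP => i' j; rewrite ord1 !mxE.
    by apply: contrapT => /eqP aj; apply: h; exists j; rewrite mxE.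
  have [//|d _] := @lev_comb a^T (fun d => a^T d 0 != 0) d0 ad0.
  move=> /lev_at_neq0; rewrite big_mkcond /= => /eqP h e; apply: h; rewrite -[RHS]e.
  by apply: eq_bigr => d' _; case: eqP => //= ->; rewrite scale0r.
have [c [s ic]] : exists c : 'I_4, exists s, i = c%:Z - 4 * s.
  have c4 : (absz (i %% 4)%Z < 4)%N by lia.
  by exists (Ordinal c4), (- (i %/ 4)%Z); rewrite /=; lia.
(* If q c <= s, a multiple of [p c] has level i = c - 4 s; otherwise a multiple of the dual basis
   vector [p'] has level 7 - i. *)
move=> nli; have [le_qs|lt_sq] := leP (q c) s.
  have := level_of_sub4 (absz (s - q c)%R) (lq c); congr level_of; lia.
exfalso; apply: nli.
pose p' := invmx (P^T *m J) *m delta_mx c 0 : 'cV[F]_4.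
have pp' d : form (p d) p' = (d == c)%:R.
  have -> : p d = P *m delta_mx d 0.
    by rewrite -colE; apply/matrixP => i' j; rewrite ord1 !mxE.
  rewrite /form trmx_mul -!mulmxA (mulmxA P^T) mulKVmx ?unitmx_mul ?unitmx_tr ?uP ?J_unit //.
  by rewrite trmx_delta mul_delta_mx_cond; case: eqP => _; rewrite !mxE ?eqxx.
(* If the coefficient at c were not integral, removing the integral terms from z would leave a
   lattice vector whose level exceeds the maximum in its class d. *)
have int_p' z : integral z -> form (M *m z) p' \in pow_p 0.
  move=> iz; set a := invmx P *m (M *m z).
  have Mz : M *m z = \sum_d a d 0 *: p d by rewrite -PE /a mulKVmx.
  have form_p' (b : 'cV[F]_4) : form (\sum_d b d 0 *: p d) p' = b c 0.
    rewrite /form linear_sum /= !mulmx_suml summxE (bigD1 c) //= big1 => [|d dc].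
      rewrite addr0 linearZ /= -!scalemxAl mxE; have := pp' c; rewrite /form eqxx => ->.
      by rewrite mulr1.
    rewrite linearZ /= -!scalemxAl mxE; have := pp' d; rewrite /form (negPf dc) => ->.
    by rewrite mulr0.
  rewrite Mz form_p'; apply: contrapT => /negP ac.
  pose D d := a d 0 \notin pow_p 0.
  have [d|d Dd ld] := @lev_comb a D c ac.
    by apply: contraNneq => ->; apply: pow_p0.
  have : level_of M (d%:Z - 4 * (q d + valuation (a d 0))).
    exists (z - \sum_(d | ~~ D d) a d 0 *: x d).
      apply: integralD => // d'; rewrite mxE summxE; apply: pow_pN.
      elim/big_ind: _ => [||d'' nD]; [exact: pow_p0|exact: pow_pD|].
      by rewrite mxE; apply: pow_pM_le (negbNE nD) (ix _ _).
    rewrite mulmxBr mulmx_sumr Mz (bigID D) /= [X in _ + X - _](_ : _ =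
      \sum_(d | ~~ D d) M *m (a d 0 *: x d)) ?addrK //.
    by apply: eq_bigr => d' _; rewrite -scalemxAr.
  move=> /maxq; move: Dd; rewrite /D inE negb_or -ltNge => /andP[_]; lia.
have [l lp'] : exists l, lev_at l p'.
  apply: lev_at_exists; apply/eqP => p'0; have := pp' c.
  by rewrite p'0 /form mulmx0 mxE eqxx => /eqP; rewrite eq_sym oner_eq0.
(* The leading coordinate of [p'] pairs nontrivially with [p (rev_ord d)], so duality forces
   [rev_ord d] to be c. *)
have [d [m p'd ld]] := lev_at_lead lp'.
have := form_lev_at (n := q (rev_ord d) + m) (lx (rev_ord d)) lp'.
rewrite -/(p (rev_ord d)) pp'; case: eqVneq => [dc|_ h]; last first.
  by have /h/valeq_neq0/eqP : (rev_ord d)%:Z - 4 * q (rev_ord d) + l =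
    3 - 4 * (q (rev_ord d) + m) by rewrite ld /=; have := ltn_ord d; lia.
rewrite ld => /(_ _)/andP[|_ /eqP]; first by rewrite /=; have := ltn_ord d; lia.
rewrite Defs.val1 dc => qm.
have lp'' : level_of M' (3 - (c%:Z - 4 * q c)).
  exists (invmx M' *m p'); last first.
    rewrite mulKVmx //; move: lp'; congr lev_at; rewrite ld.
    by have := congr1 val dc; have := ltn_ord d; rewrite /=; lia.
  (* Pairing with the columns of M reads off the coordinates of M'^-1 p' up to units. *)
  move=> j; have := @int_p' (delta_mx (rev_ord j) 0).
  rewrite -[p'](mulKVmx uM') formM (pow_pZ _ _ vmu) subr0 mulKVmx //.
  set y := invmx M' *m p'; rewrite form_sum (bigD1 (rev_ord j)) //= rev_ordK big1.
    rewrite addr0 mxE !eqxx mul1r => h.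
    have {}h : (if (rev_ord j < 2)%N then 1 else -1) * y j 0 \in pow_p 0.
      apply: h => i'; rewrite mxE eqxx andbT; case: eqP => _; last exact: pow_p0.
      by rewrite (valeq_mem _ (valeq1 F)).
    by move: h; case: ifP; rewrite ?mul1r // mulN1r => _ /pow_pN; rewrite opprK.
  by move=> i' i'j; rewrite mxE (negPf i'j) mul0r mulr0.
have := level_of_sub4 (absz (q c - 1 - s)%R) lp''; congr level_of; lia.
Qed.

End LatticeDuality.

(** * Unipotent elements and fixed vectors *)

Section SymplecticElements.
Variable F : localFieldType.
Implicit Types (a b x y : 'cV[F]_4) (g k S : 'M[F]_4) (mu : F).
Local Notation J := (J F).

Lemma trJ : J^T = - J.
Proof.
apply/matrixP => i j; rewrite !mxE; move: i j.
by do 2!elim/ord4_ind; rewrite /= ?oppr0 ?opprK.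
Qed.

Lemma JJ : J *m J = - 1%:M.
Proof.
apply/matrixP => i j; rewrite !mxE sum_ord4 !mxE.
move: i j; do 2!elim/ord4_ind; rewrite /=; ring.
Qed.

(** The squared determinant is enough to decide invertibility and to find the valuation of the
    determinant. *)
Lemma det_similitude g mu : g^T *m J *m g = mu *: J -> \det g ^+ 2 = mu ^+ 4.
Proof.
move=> /(congr1 determinant); rewrite !det_mulmx det_tr detZ.
have dJ : \det J != 0 by rewrite -unitfE -unitmxE J_unit.
by move=> e; apply: (mulIf dJ); rewrite -e; ring.
Qed.

Lemma similitude_unitmx g mu : mu != 0 -> g^T *m J *m g = mu *: J -> g \in unitmx.
Proof.
move=> mu0 /det_similitude e; rewrite unitmxE unitfE.
apply: contraNneq mu0 => d0; move: e; rewrite d0 expr0n /= => /esym/eqP.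
by rewrite expf_eq0.
Qed.

Lemma similitude_GSp4 g mu : mu != 0 -> g^T *m J *m g = mu *: J -> GSp4 g.
Proof. by move=> mu0 e; split; [exact: similitude_unitmx e|exists mu]. Qed.

Lemma det_similitude_unit g mu :
  valeq 0 mu -> g^T *m J *m g = mu *: J -> o_unit (\det g).
Proof.
move=> vmu e; have ug := similitude_unitmx (valeq_neq0 vmu) e.
have d0 : \det g != 0 by rewrite -unitfE -unitmxE.
have := valeqX 4 vmu; rewrite -(det_similitude e) mul0r.
have := valeqX 2 (valeq_valuation d0) => /andP[_ /eqP] e2.
rewrite /valeq e2 => /andP[_].
by rewrite /o_unit d0 mulf_eq0 orbF.
Qed.

(** The left-hand product expands to J + J (S - S^T - S^T J S) J. *)
Lemma symplectic_add1 S :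
  S - S^T = S^T *m J *m S -> (1%:M + S *m J)^T *m J *m (1%:M + S *m J) = J.
Proof.
move=> e; have BJA : J *m S^T *m J *m S *m J = J *m S *m J - J *m S^T *m J.
  by rewrite -mulmxBl -mulmxBr e !mulmxA.
rewrite [(_ + _)^T]linearD /= trmx1 trmx_mul trJ mulNmx.
rewrite mulmxDr !mulmxDl mulmx1 mul1mx !mulNmx mulmx1 !mulmxA BJA.
by rewrite opprB [X in _ + X]addrC subrK subrK.
Qed.

Lemma outerJE a b (i j : 'I_4) : (a *m b^T *m J) i j =
  a i 0 * ((if (j < 2)%N then -1 else 1) * b (rev_ord j) 0).
Proof. by rewrite -mulmxA mxE big_ord1 trJE. Qed.

Lemma form_mxE a b : a^T *m J *m b = (form a b)%:M.
Proof. by rewrite [LHS]mx11_scalar. Qed.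

Lemma rev_ord4E :
  (rev_ord o0 = o3) * (rev_ord o1 = o2) * (rev_ord o2 = o1) * (rev_ord o3 = o0).
Proof. by do !split; apply: val_inj. Qed.

Lemma formE a b : form a b =
  a o0 0 * b o3 0 + a o1 0 * b o2 0 - a o2 0 * b o1 0 - a o3 0 * b o0 0.
Proof. by rewrite form_sum sum_ord4 /= !rev_ord4E; ring. Qed.

Lemma formC a b : form b a = - form a b.
Proof. by rewrite !formE; ring. Qed.

Lemma form_alt a : form a a = 0.
Proof. by rewrite formE; ring. Qed.

Lemma outer_form x a b y :
  (x *m a^T) *m J *m (b *m y^T) = form a b *: (x *m y^T).
Proof.
by rewrite !mulmxA -(mulmxA x) -(mulmxA x) form_mxE mul_mx_scalar -scalemxAl.
Qed.

(** For orthogonal a and b the condition reads s = s', the usual short root element; the quadratic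
    term corrects for a nonzero pairing. *)
Lemma symplectic_rank2 s s' a b : s - s' = - (s * s') * form a b ->
  let S := s *: (a *m b^T) + s' *: (b *m a^T) in
  S - S^T = S^T *m J *m S.
Proof.
move=> e S.
have -> : S^T = s *: (b *m a^T) + s' *: (a *m b^T).
  by rewrite /S linearD !linearZ /= !trmx_mul !trmxK.
rewrite /S !mulmxDl !mulmxDr -!scalemxAl -!scalemxAr !outer_form !form_alt (formC a b).
rewrite !scale0r !scaler0 !scalerA add0r addr0.
apply/matrixP => i j; rewrite !mxE.
set P := \sum_k _; set Q := \sum_k _.
transitivity ((s - s') * (P - Q)); first by ring.
by rewrite e; ring.
Qed.

End SymplecticElements.

(** This is where the bound 5 enters: n = 5 would give h = 2 and e = 1, violating h <= 2 - e. *)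
Lemma half_lt5 (n : nat) : (n < 5)%N ->
  exists h e : int, [/\ n%:Z = 2 * h + e, 0 <= e <= 1 & h <= 2 - e].
Proof. by move=> n5; exists (n %/ 2)%N, (n %% 2)%N; split; lia. Qed.

(** * The affine generic character and the lower bound for the conductor *)

Section AffineGenericCharacter.
Variables (R : realType) (F : localFieldType) (psi : F -> R[i]) (varpi t : F).
Hypothesis psi_char : additive_character psi.
Hypothesis psi_triv : trivial_exactly_on_o psi.
Hypothesis varpi_unif : uniformizer varpi.
Hypothesis t_unit : o_unit t.
Implicit Types (k u : 'M[F]_4).
Local Notation J := (J F).
Local Notation psi0 := (psi0 psi varpi).

Lemma psi0D x y : psi0 (x + y) = psi0 x * psi0 y.
Proof. by rewrite /Defs.psi0 mulrDr (proj2 psi_char). Qed.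

Lemma psi0_p x : x \in pow_p 1 -> psi0 x = 1.
Proof.
move=> x1; apply: (proj1 psi_triv).
by rewrite (pow_pZ _ _ (valeqV varpi_unif)).
Qed.

Lemma psi0_neq0 x : psi0 x != 0.
Proof.
apply/eqP => x0; have := psi0D x (- x); rewrite subrr x0 mul0r psi0_p ?pow_p0 //.
by move/eqP; rewrite oner_eq0.
Qed.

Lemma psi0_nontrivial : exists2 y, valeq 0 y & psi0 y != 1.
Proof.
have [_ [x x1 px]] := psi_triv; exists (varpi * x); last first.
  by rewrite /Defs.psi0 mulKf // (valeq_neq0 varpi_unif).
rewrite valeqE !(pow_pZ _ _ varpi_unif) !add0r x1 /=.
by apply: contra px => x0; rewrite (proj1 psi_triv).
Qed.

(** As c runs over the units so does c z, and [psi0] is nontrivial at some unit; it does not see the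
    error term r. *)
Lemma psi0_unit_absurd z :
  valeq 0 z -> ~ (forall c, valeq 0 c -> exists2 r, r \in pow_p 1 & psi0 (c * z + r) = 1).
Proof.
move=> z0 h; have [y y0 /eqP] := psi0_nontrivial; apply.
have [|r r1] := h (y / z); first by have := valeqM y0 (valeqV z0); rewrite subr0.
by rewrite divfK ?(valeq_neq0 z0) // psi0D (psi0_p r1) mulr1.
Qed.

Lemma chi_KprimeE k : chi_Kprime psi varpi t k =
  psi0 (k o0 o1 + k o1 o2 + t * varpi^-1 * k o3 o0).
Proof. by rewrite /chi_Kprime !inord4E. Qed.

Lemma Kprime1 : Kprime (1%:M : 'M[F]_4).
Proof.
split=> [|i j]; last by rewrite mxE subrr pow_p0.
apply: (@similitude_GSp4 _ _ 1); first exact: oner_neq0.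
by rewrite trmx1 mul1mx mulmx1 scale1r.
Qed.

Lemma H_Kprime k : Kprime k -> H k.
Proof. by move=> Kk; exists 1, k; rewrite oner_neq0 scale1r. Qed.

Lemma chi_pm_Kprime eps k :
  Kprime k -> chi_pm psi varpi t eps k = chi_Kprime psi varpi t k.
Proof.
move=> Kk; rewrite /chi_pm; case: asboolP => [_|/(_ (H_Kprime Kk))//].
by rewrite -{1}[k]scale1r chiE // oner_neq0.
Qed.

(** The value f(u g) = f(g k) is computed twice: u acts through the character, and k fixes f. *)
Lemma fixed_vector_chi eps n f g u k : sigma_chi psi varpi t eps f ->
  (forall k, paramodular n k -> right_translation k f = f) ->
  GSp4 g -> f g != 0 -> Kprime u -> paramodular n k -> u *m g = g *m k ->
  chi_Kprime psi varpi t u = 1.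
Proof.
move=> [_ fH _ _] fK Gg fg Ku Kk ugk.
have := fH u g (or_introl (H_Kprime Ku)) Gg; rewrite chi_pm_Kprime // ugk.
have -> : f (g *m k) = f g by rewrite -{2}(fK k Kk).
by rewrite -{1}[f g]mul1r => /(mulIf fg).
Qed.

(** The (i,j) entry has valuation at least -floor((j - i - 1)/4), which is 0 above the diagonal and
    1 elsewhere. *)
Lemma levle_outer_Kprime c l m n a b : c \in pow_p n -> levle l a -> levle m b ->
  l + m <= 2 + 4 * n -> forall i j : 'I_4,
  (c *: (a *m b^T) *m J) i j \in pow_p (if (i < j)%N then 0 else 1 : int).
Proof.
move=> cn la mb lm i j; rewrite -scalemxAl mxE outerJE.
have ab : c * (a i 0 * b (rev_ord j) 0) \in pow_p (if (i < j)%N then 0 else 1 : int).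
  apply: pow_pM_le (cn) (pow_pM (la i) (mb (rev_ord j))) => /=.
  by have := ltn_ord i; have := ltn_ord j; case: ifP => /=; lia.
by case: ifP => _; rewrite ?mul1r // mulN1r !mulrN pow_pN.
Qed.

(** * Levels forbidden by a fixed vector *)

Section FixedVector.
Variables (eps : R[i]) (f : 'M[F]_4 -> R[i]) (g : 'M[F]_4) (mu : F).
Variables (n : nat) (e h : int).
Hypothesis f_sigma : sigma_chi psi varpi t eps f.
Hypothesis f_fixed : forall k, paramodular n k -> right_translation k f = f.
Hypothesis mu_unit : valeq 0 mu.
Hypothesis g_sim : g^T *m J *m g = mu *: J.
Hypothesis fg : f g != 0.
Hypothesis nE : n%:Z = 2 * h + e.

(* N(a,b) = g (box a b).  The exponents are chosen so that the symplectic dual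
   of N(a,b) is N(-a-e,-b). *)
Definition box (a b : int) (x : 'cV[F]_4) :=
  forall i : 'I_4, x i 0 \in pow_p (nth 0 [:: a - h; b; b; a + h + e] i).

(** The entries fall into four kinds, one per inequality: the row index and the index paired with
    the column lie both in {0,3}, both in {1,2}, or one in each. *)
Lemma box_outer_paramodular m a b a' b' x y c : c \in pow_p m -> box a b x -> box a' b' y ->
  0 <= m + a + a' + e -> 0 <= m + b + b' -> h <= m + a + b' -> h <= m + a' + b ->
  forall i j : 'I_4,
  (c *: (x *m y^T) *m J) i j \in pow_p (paramodular_exponent n i j).
Proof.
move=> cm bx by' h1 h2 h3 h4 i j; rewrite -scalemxAl mxE outerJE.
have xy : c * (x i 0 * y (rev_ord j) 0) \in pow_p (paramodular_exponent n i j).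
  apply: pow_pM_le (cm) (pow_pM (bx i) (by' (rev_ord j))).
  move: i j; do 2!elim/ord4_ind; rewrite /paramodular_exponent /=; lia.
by case: ifP => _; rewrite ?mul1r // mulN1r !mulrN pow_pN.
Qed.

(* 1 + S J = g (1 + mu T J) g^-1. *)
Lemma chi_unipotent (T : 'M[F]_4) : let S := g *m T *m g^T in
  S - S^T = S^T *m J *m S ->
  (forall i j : 'I_4, (S *m J) i j \in pow_p (if (i < j)%N then 0 else 1 : int)) ->
  (forall i j : 'I_4, (T *m J) i j \in pow_p (paramodular_exponent n i j)) ->
  psi0 ((S *m J) o0 o1 + (S *m J) o1 o2 + t * varpi^-1 * (S *m J) o3 o0) = 1.
Proof.
move=> S sympS SK TP; have sympu := symplectic_add1 sympS.
set u := 1%:M + S *m J in sympu.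
pose k1 := 1%:M + mu *: (T *m J).
have ugk : u *m g = g *m k1.
  rewrite mulmxDl mulmxDr mul1mx mulmx1 /S -!mulmxA (mulmxA g^T) g_sim.
  by rewrite -!scalemxAr.
have mu0 := valeq_neq0 mu_unit.
have sympk : k1^T *m J *m k1 = 1 *: J.
  apply: (scalerI mu0); rewrite scale1r scalemxAl scalemxAr -g_sim.
  rewrite !mulmxA -trmx_mul -!mulmxA -ugk trmx_mul -(mulmxA g^T).
  by rewrite (mulmxA J) (mulmxA u^T) (mulmxA u^T) sympu !mulmxA.
have Ku : Kprime u.
  split; first by apply: similitude_GSp4 (oner_neq0 _) _; rewrite scale1r.
  move=> i j; have -> : u i j = (i == j)%:R + (S *m J) i j by rewrite mxE [1%:M _ _]mxE.
  by rewrite addrC addKr.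
have Pk : paramodular n k1.
  split; first exact: similitude_GSp4 (oner_neq0 _) sympk.
    move=> i j; rewrite /k1 mxE [X in _ + X]mxE; apply: pow_pD.
      rewrite mxE; case: eqP => [<-|_]; last exact: pow_p0.
      rewrite (valeq_mem _ (valeq1 F)); move: i {j}.
      by elim/ord4_ind.
    by rewrite (pow_pZ _ _ mu_unit) subr0.
  exact: det_similitude_unit (valeq1 F) sympk.
have := fixed_vector_chi f_sigma f_fixed (similitude_GSp4 mu0 g_sim) fg Ku Pk ugk.
rewrite chi_KprimeE /u; congr (psi0 _ = 1).
by rewrite ![(1%:M + _) _ _]mxE ![(1%:M) _ _]mxE /= !add0r.
Qed.

Definition box_level a b l := exists2 x, box a b x & lev_at l (g *m x).

(** The character is evaluated on the transvection 1 + c v v^T J. The value of m is the least one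
    for which [levle_outer_Kprime] applies at level l. *)
Lemma box_level_transvection m a b x l (c : F) : (l == 1) && (m == 0) || (l == 3) && (m == 1) ->
  0 <= m + 2 * a + e -> 0 <= m + 2 * b -> h <= m + a + b ->
  box a b x -> levle l (g *m x) -> c \in pow_p m ->
  let v := g *m x in
  psi0 (c * (v o1 0 ^+ 2 - v o0 0 * v o2 0 - t * varpi^-1 * v o3 0 ^+ 2)) = 1.
Proof.
move=> lm h1 h2 h3 bx lv cm v.
have Sv : g *m (c *: (x *m x^T)) *m g^T = c *: (v *m v^T).
  by rewrite -scalemxAr -scalemxAl trmx_mul !mulmxA.
have := @chi_unipotent (c *: (x *m x^T)); rewrite /= Sv.
have -> : (c *: (v *m v^T))^T = c *: (v *m v^T) by rewrite linearZ /= trmx_mul trmxK.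
move=> H1; rewrite -{}H1.
- rewrite -!scalemxAl ![fun_of_matrix (c *: _) _ _]mxE !outerJE /= !rev_ord4E.
  by congr (psi0 _); ring.
- by rewrite subrr -!scalemxAl -!scalemxAr outer_form form_alt scale0r !scaler0.
- by apply: (levle_outer_Kprime cm lv lv); move: lm; lia.
- by apply: (box_outer_paramodular cm bx bx); lia.
Qed.

(** At level 1 the coordinate v_1 is a unit, so c v_1^2 is the main term; the two other terms lie in
    p. *)
Lemma no_box_level1 a b :
  0 <= 2 * a + e -> 0 <= b -> h <= a + b -> ~ box_level a b 1.
Proof.
move=> h1 h2 h3 [x bx lx]; have [lv _] := lx; set v := g *m x in lx lv.
have v1 : valeq 0 (v o1 0).
  have [j [m vj]] := lev_at_lead lx; move: j vj; elim/ord4_ind => /= vj; try lia.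
  by move=> m0; have <- : m = 0 by lia.
have := valeqX 2 v1; rewrite mul0r => /psi0_unit_absurd; apply=> c c0.
exists (c * (- (v o0 0 * v o2 0) - t * varpi^-1 * v o3 0 ^+ 2)); last first.
  rewrite -mulrDr addrA.
  apply: (@box_level_transvection 0 a b x 1) => //; try lia.
  exact: valeq_pow_p c0.
rewrite (pow_pZ _ _ c0) subr0; have := lv o0; have := lv o2; have := lv o3 => /=.
rewrite /= => l3 l2 l0; apply: pow_pD.
  by rewrite pow_pN //; apply: pow_pM_le l0 l2.
rewrite pow_pN // -mulrA (pow_pZ _ _ t_unit) (pow_pZ _ _ (valeqV varpi_unif)).
exact: (pow_pM_le _ l3 l3).
Qed.

(** At level 3 the coordinate v_3 is a unit. Scaling by varpi turns the affine root term into a unit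
    and sends the others into p; it also accounts for the summands 1 in the hypotheses. *)
Lemma no_box_level3 a b :
  0 <= 2 * a + e + 1 -> 0 <= 2 * b + 1 -> h <= a + b + 1 -> ~ box_level a b 3.
Proof.
move=> h1 h2 h3 [x bx lx]; have [lv _] := lx; set v := g *m x in lx lv.
have v3 : valeq 0 (v o3 0).
  have [j [m vj]] := lev_at_lead lx; move: j vj; elim/ord4_ind => /= vj; try lia.
  by move=> m0; have <- : m = 0 by lia.
have : valeq 0 (- t * v o3 0 ^+ 2).
  by have := valeqM t_unit (valeqX 2 v3); rewrite mul0r addr0 mulNr valeqN.
move=> /psi0_unit_absurd; apply=> c c0; have w0 := valeq_neq0 varpi_unif.
exists (c * varpi * (v o1 0 ^+ 2 - v o0 0 * v o2 0)); last first.
  have -> : c * (- t * v o3 0 ^+ 2) + c * varpi * (v o1 0 ^+ 2 - v o0 0 * v o2 0) =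
    c * varpi * (v o1 0 ^+ 2 - v o0 0 * v o2 0 - t * varpi^-1 * v o3 0 ^+ 2) by field.
  apply: (@box_level_transvection 1 a b x 3) => //; try lia.
  by have := valeqM c0 varpi_unif; rewrite add0r => /valeq_pow_p.
rewrite -mulrA (pow_pZ _ _ c0) (pow_pZ _ _ varpi_unif).
have := lv o0; have := lv o1; have := lv o2; rewrite /= => l2 l1 l0.
by apply: pow_pB; [exact: (pow_pM_le _ l1 l1)|apply: pow_pM_le l0 l2].
Qed.

(** For v of level 0 and w of level 2, the short root element has the unit -c v_0 w_2 in its (0,1)
    entry, and every other contribution to the character lies in p. *)
Lemma no_box_level02 a b a' b' :
  0 <= a + a' + e -> 0 <= b + b' -> h <= a + b' -> h <= a' + b ->
  box_level a b 0 -> ~ box_level a' b' 2.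
Proof.
move=> h1 h2 h3 h4 [x bx lx] [y by' ly].
have [lv _] := lx; have [lw _] := ly.
set v := g *m x in lx lv; set w := g *m y in ly lw.
have v0 : valeq 0 (v o0 0).
  have [j [m vj]] := lev_at_lead lx; move: j vj; elim/ord4_ind => /= vj; try lia.
  by move=> m0; have <- : m = 0 by lia.
have w2 : valeq 0 (w o2 0).
  have [j [m vj]] := lev_at_lead ly; move: j vj; elim/ord4_ind => /= vj; try lia.
  by move=> m0; have <- : m = 0 by lia.
have := valeqM v0 w2; rewrite addr0 -valeqN => /psi0_unit_absurd; apply=> c c0.
have d1 : form v w \in pow_p 1 by apply: form_levle lv lw _.
have r0 : valeq 0 (1 - c * form v w).
  by apply: valeqDl (valeq1 F) _; rewrite pow_pN // (pow_pZ _ _ c0).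
(* The value of s that makes 1 + (c v w^T + s w v^T) J symplectic. *)
have r_neq0 := valeq_neq0 r0; pose s := c / (1 - c * form v w).
have s0 : valeq 0 s by have := valeqM c0 (valeqV r0); rewrite oppr0 addr0.
pose T := c *: (x *m y^T) + s *: (y *m x^T).
have Sv : g *m T *m g^T = c *: (v *m w^T) + s *: (w *m v^T).
  rewrite mulmxDr mulmxDl -!scalemxAr -!scalemxAl !trmx_mul.
  by rewrite !mulmxA.
have sympS : c - s = - (c * s) * form v w by rewrite /s; field.
have := @chi_unipotent T; rewrite /= Sv => chi1.
have {chi1} := chi1 (symplectic_rank2 sympS).
rewrite !mulmxDl => chi1.
exists (- (s * (w o0 0 * v o2 0)) + (c + s) * (v o1 0 * w o1 0)
        - (c + s) * (t * varpi^-1 * (v o3 0 * w o3 0))).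
  have cs0 : c + s \in pow_p 0 by apply: pow_pD; apply: valeq_pow_p.
  have := lv o1; have := lv o2; have := lv o3.
  have := lw o0; have := lw o1; have := lw o3; rewrite /= => w3 w1 w0' v3 v2 v1.
  apply: pow_pB; first apply: pow_pD.
  - by rewrite pow_pN // (pow_pZ _ _ s0); apply: pow_pM_le w0' v2.
  - by apply: pow_pM_le (cs0) (pow_pM v1 w1).
  apply: (@pow_pM_le _ 0 1) => //.
  rewrite -mulrA (pow_pZ _ _ t_unit) (pow_pZ _ _ (valeqV varpi_unif)).
  exact: (pow_pM_le _ v3 w3).
rewrite -{}chi1.
- rewrite -!scalemxAl ![fun_of_matrix (_ + _) _ _]mxE.
  rewrite ![fun_of_matrix (c *: _) _ _]mxE ![fun_of_matrix (s *: _) _ _]mxE.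
  by rewrite !outerJE /= !rev_ord4E; congr (psi0 _); ring.
- move=> i j; rewrite mxE; apply: pow_pD.
    exact: (levle_outer_Kprime (valeq_pow_p c0) lv lw).
  exact: (levle_outer_Kprime (valeq_pow_p s0) lw lv).
- move=> i j; rewrite mxE; apply: pow_pD.
    by apply: (box_outer_paramodular (valeq_pow_p c0) bx by'); rewrite add0r.
  apply: (box_outer_paramodular (valeq_pow_p s0) by' bx); rewrite add0r //.
    by rewrite (addrC a').
  by rewrite (addrC b').
Qed.

Definition box_mx (a b : int) : 'M[F]_4 :=
  diag_mx (\row_i varpi ^ nth 0 [:: a - h; b; b; a + h + e] i).

Lemma box_mxE a b x (i : 'I_4) : (box_mx a b *m x) i (0 : 'I_1) =
  varpi ^ nth 0 [:: a - h; b; b; a + h + e] i * x i 0.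
Proof. by rewrite mul_diag_mx !mxE. Qed.

Lemma box_level_of a b l : box_level a b l <-> level_of (g *m box_mx a b) l.
Proof.
split=> -[x bx lx]; last first.
  exists (box_mx a b *m x); last by rewrite mulmxA.
  move=> i; rewrite box_mxE; apply: pow_pM_le (bx i); first by rewrite addr0.
  exact/valeq_pow_p/valeq_varpi.
pose y : 'cV[F]_4 := \col_i (varpi ^ (- nth 0 [:: a - h; b; b; a + h + e] i) * x i 0).
exists y.
  move=> i; rewrite mxE; apply: pow_pM_le (bx i); last exact/valeq_pow_p/valeq_varpi.
  by rewrite addNr.
rewrite -mulmxA (_ : box_mx a b *m y = x) //.
apply/matrixP => i j; rewrite ord1 box_mxE mxE mulrA -expfzDr ?subrr ?expr0z ?mul1r //.
exact: valeq_neq0 varpi_unif.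
Qed.

Lemma box_mx_dual a b : box_mx a b *m J *m box_mx (- a - e) (- b) = J.
Proof.
have w0 := valeq_neq0 varpi_unif.
apply/matrixP => i j; rewrite mul_mx_diag mul_diag_mx !mxE mulrAC -expfzDr //.
move: i j; do 2!elim/ord4_ind; rewrite /= ?mulr0 //.
- by rewrite (_ : _ + _ = 0) ?mul1r //; lia.
- by rewrite (_ : _ + _ = 0) ?mul1r //; lia.
- by rewrite (_ : _ + _ = 0) ?mul1r //; lia.
- by rewrite (_ : _ + _ = 0) ?mul1r //; lia.
Qed.

Lemma box_level_dual a b i : box_level a b i <-> ~ box_level (- a - e) (- b) (7 - i).
Proof.
rewrite !box_level_of; apply: (level_dual varpi_unif _ _ mu_unit).
  rewrite unitmx_mul (similitude_unitmx (valeq_neq0 mu_unit) g_sim) /=.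
  by have := J_unit F; rewrite -(box_mx_dual a b) !unitmx_mul => /andP[/andP[]].
rewrite trmx_mul tr_diag_mx -!mulmxA (mulmxA J g) (mulmxA g^T) (mulmxA g^T) g_sim.
by rewrite -scalemxAl -scalemxAr mulmxA box_mx_dual.
Qed.

Lemma box_level_mono a b a' b' i :
  a' <= a -> b' <= b -> box_level a b i -> box_level a' b' i.
Proof.
move=> aa bb [x bx lx]; exists x => // j; apply: pow_p_le (bx j).
by move: j {bx}; elim/ord4_ind => /=; lia.
Qed.

Lemma box_level_shift a b i : box_level a b i <-> box_level (a + 1) (b + 1) (i - 4).
Proof.
split=> -[x bx lx].
  exists (varpi *: x); last by rewrite -scalemxAr; apply/(lev_atZ _ _ varpi_unif).
  move=> j; rewrite mxE (pow_pZ _ _ varpi_unif); apply: pow_p_le (bx j).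
  by move: j; elim/ord4_ind => /=; lia.
have vV := valeqV varpi_unif.
exists (varpi^-1 *: x).
  move=> j; rewrite mxE (pow_pZ _ _ vV); apply: pow_p_le (bx j).
  by move: j; elim/ord4_ind => /=; lia.
rewrite -scalemxAr; have -> : i = i - 4 - 4 * (-1) by lia.
by apply/(lev_atZ _ _ vV).
Qed.

(** The vector is split along the two orthogonal planes. If the images of the parts have different
    levels, the larger is i; if both have level j, then i = j or cancellation gives i < j. *)
Lemma box_level_sum a b a' b' i : a' <= a -> b <= b' -> box_level a' b i ->
  [\/ box_level a b i, box_level a' b' i
    | exists j, [/\ i < j, box_level a b j & box_level a' b' j]].
Proof.
move=> aa bb [x bx lx].
pose y : 'cV[F]_4 := \col_i if (i == o0) || (i == o3) then 0 else x i 0.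
pose z : 'cV[F]_4 := \col_i if (i == o0) || (i == o3) then x i 0 else 0.
have xyz : x = y + z.
  by apply/matrixP => j j'; rewrite ord1 !mxE; case: ifP; rewrite ?add0r ?addr0.
have by_ : box a b y.
  move=> j; rewrite mxE; have := bx j.
  by move: j; elim/ord4_ind => /= _ //; apply: pow_p0.
have bz : box a' b' z.
  move=> j; rewrite mxE; have := bx j.
  by move: j; elim/ord4_ind => /= _ //; apply: pow_p0.
move: lx; rewrite xyz mulmxDr => lx.
have [y0|/lev_at_exists[l ly]] := eqVneq (g *m y) 0.
  by apply: Or32; exists z => //; rewrite y0 add0r in lx.
have [z0|/lev_at_exists[l' lz]] := eqVneq (g *m z) 0.
  by apply: Or31; exists y => //; rewrite z0 addr0 in lx.
have [ll'|l'l|ll'] := ltgtP l l'.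
- have lz' : lev_at l' (g *m y + g *m z).
    by rewrite addrC; apply: lev_atD => //; apply: levle_mono (proj1 ly); lia.
  by apply: Or32; exists z => //; rewrite (lev_at_inj lx lz').
- have ly' : lev_at l (g *m y + g *m z).
    by apply: lev_atD => //; apply: levle_mono (proj1 lz); lia.
  by apply: Or31; exists y => //; rewrite (lev_at_inj lx ly').
rewrite -ll' in lz.
have [il|il|il] := ltgtP i l.
- by apply: Or33; exists l; split=> //; [exists y|exists z].
- case: lx => _ []; apply: levleD.
    by apply: levle_mono (proj1 ly); lia.
  by apply: levle_mono (proj1 lz); lia.
- by apply: Or31; exists y => //; rewrite il.
Qed.

Lemma fixed_vector_absurd : 0 <= e <= 1 -> h <= 2 - e -> False.
Proof.
move=> e01 he; exact: (levels_absurd e01 he box_level_mono box_level_shift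
  box_level_dual box_level_sum no_box_level1 no_box_level3 no_box_level02).
Qed.

End FixedVector.

Lemma varpi_t_valeq : valeq 1 (varpi / t).
Proof. by have := valeqM varpi_unif (valeqV t_unit). Qed.

Lemma g_chi_similitude :
  (g_chi varpi t)^T *m J *m g_chi varpi t = - (varpi / t) *: J.
Proof.
apply/matrixP => i j; rewrite !mxE sum_ord4 !mxE !sum_ord4 !mxE.
by move: i j; do 2!elim/ord4_ind; rewrite /=; ring.
Qed.

Lemma chi_scalar z : z != 0 -> chi psi varpi t (z *: 1%:M) = 1.
Proof.
move=> z0; rewrite chiE //; last exact: Kprime1.
rewrite chi_KprimeE !mxE psi0_p //= !add0r mulr0; exact: pow_p0.
Qed.

Lemma H_scalar z : z != 0 -> H (z *: (1%:M : 'M[F]_4)).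
Proof. by move=> z0; exists z, 1%:M; split=> //; apply: Kprime1. Qed.

Lemma Hprime_g_chi : Hprime varpi t (g_chi varpi t).
Proof.
right; exists 1%:M; last by rewrite mulmx1.
exact/H_Kprime/Kprime1.
Qed.

Lemma chi_pm_g_chi eps : chi_pm psi varpi t eps (g_chi varpi t) = eps.
Proof.
have w0 := valeq_neq0 varpi_unif; have t0 := valeq_neq0 t_unit.
have [_] := chi_pmE psi eps w0 t0 (H_scalar (oner_neq0 _)).
by rewrite scale1r mulmx1 -[1%:M]scale1r chi_scalar ?oner_neq0 // mulr1.
Qed.

Lemma sigma_chi_conductor_ge eps n : eps != 0 ->
  has_fixed_vector (sigma_chi psi varpi t eps) (paramodular n) -> (5 <= n)%N.
Proof.
move=> eps0 [f [fs f0 ff]]; rewrite leqNgt; apply/negP => n5.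
have [fN fH _ _] := fs.
have [g fg] : exists g, f g != 0.
  apply: contrapT => h; apply: f0; apply/funext => g; apply/eqP.
  by apply: contrapT => fg; apply: h; exists g; apply/negP.
have Gg : GSp4 g by apply: contrapT => /fN g0; rewrite g0 eqxx in fg.
have w0 := valeq_neq0 varpi_unif; have t0 := valeq_neq0 t_unit.
(* Multiplying g by g_chi and by a scalar makes its similitude factor a unit. *)
have [g1 [q [mu1 [fg1 vmu1 g1s]]]] : exists g1 (q : int) mu1,
    [/\ f g1 != 0, valeq (2 * q) mu1 & g1^T *m J *m g1 = mu1 *: J].
  have [_ [mu mu0 gs]] := Gg; have vmu := valeq_valuation mu0.
  have [par|par] : valuation mu = 2 * (valuation mu %/ 2)%Z \/
     valuation mu + 1 = 2 * ((valuation mu %/ 2)%Z + 1) by lia.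
    by exists g, (valuation mu %/ 2)%Z, mu; rewrite -par.
  exists (g_chi varpi t *m g), ((valuation mu %/ 2)%Z + 1), (mu * - (varpi / t)).
  rewrite (fH _ _ Hprime_g_chi Gg) chi_pm_g_chi mulf_neq0 //; split=> //.
    by rewrite -par; apply: valeqM => //; rewrite valeqN; apply: varpi_t_valeq.
  rewrite trmx_mul -!mulmxA (mulmxA J) (mulmxA _^T (J *m _)) (mulmxA (g_chi _ _)^T).
  by rewrite g_chi_similitude -scalemxAl -scalemxAr mulmxA gs scalerA mulrC.
have mu1_0 := valeq_neq0 vmu1.
(* A scalar multiplies the similitude factor by its square, which removes the even valuation 2 q; f
   does not change, as the central character is trivial. *)
have G1 := similitude_GSp4 mu1_0 g1s; set z := varpi ^ (- q).
have z0 : z != 0 by apply: valeq_neq0 (valeq_varpi varpi_unif _).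
have fzg1 : f (z *: g1) != 0.
  have -> : z *: g1 = (z *: 1%:M) *m g1 by rewrite -scalemxAl mul1mx.
  rewrite (fH _ _ (or_introl (H_scalar z0)) G1) (chi_pmE _ _ _ _ _).1 //; last exact: H_scalar.
  by rewrite chi_scalar // mul1r.
have zg1s : (z *: g1)^T *m J *m (z *: g1) = (z ^+ 2 * mu1) *: J.
  by rewrite [(z *: g1)^T]linearZ /= -!scalemxAl -scalemxAr g1s !scalerA.
have vmu : valeq 0 (z ^+ 2 * mu1).
  have := valeqM (valeqX 2 (valeq_varpi varpi_unif (- q))) vmu1.
  by rewrite (mulrC _ 2%:Z) mulrN addNr.
have [h [e [nE e01 he]]] := half_lt5 n5.
exact: (fixed_vector_absurd fs ff vmu zg1s fzg1 nE e01 he).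
Qed.

End AffineGenericCharacter.

(** * The groups K(p^n) and H' *)

Section Groups.
Variable F : localFieldType.
Implicit Types (g k : 'M[F]_4) (mu : F).
Local Notation J := (J F).

Lemma similitudeM g g' mu mu' : g^T *m J *m g = mu *: J ->
  g'^T *m J *m g' = mu' *: J -> (g *m g')^T *m J *m (g *m g') = (mu * mu') *: J.
Proof.
move=> gs gs'; rewrite trmx_mul -!mulmxA (mulmxA J) (mulmxA g^T) (mulmxA g^T) gs.
by rewrite -scalemxAl -scalemxAr mulmxA gs' scalerA.
Qed.

Lemma similitudeV g mu : mu != 0 -> g^T *m J *m g = mu *: J ->
  (invmx g)^T *m J *m invmx g = mu^-1 *: J.
Proof.
move=> mu0 gs; have ug := similitude_unitmx mu0 gs.
apply: (scalerI mu0); rewrite scalerA divff // scale1r scalemxAl scalemxAr -gs.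
by rewrite -!mulmxA mulmxV // mulmx1 mulmxA trmx_inv mulVmx ?unitmx_tr // mul1mx.
Qed.

Lemma similitudeZ z g mu : g^T *m J *m g = mu *: J ->
  (z *: g)^T *m J *m (z *: g) = (z ^+ 2 * mu) *: J.
Proof.
by move=> gs; rewrite [(z *: g)^T]linearZ /= -!scalemxAl -scalemxAr gs !scalerA.
Qed.

Lemma GSp4M g g' : GSp4 g -> GSp4 g' -> GSp4 (g *m g').
Proof.
move=> [_ [mu mu0 gs]] [_ [mu' mu'0 gs']].
exact: similitude_GSp4 (mulf_neq0 mu0 mu'0) (similitudeM gs gs').
Qed.

Lemma GSp4V g : GSp4 g -> GSp4 (invmx g).
Proof.
by move=> [_ [mu mu0 gs]]; apply: similitude_GSp4 (similitudeV mu0 gs); rewrite invr_eq0.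
Qed.

Lemma mulJmxE (A : 'M[F]_4) (i j : 'I_4) :
  (J *m A) i j = (if (i < 2)%N then 1 else -1) * A (rev_ord i) j.
Proof.
rewrite mxE sum_ord4 !JE; move: i; elim/ord4_ind; rewrite /= rev_ord4E;
  by rewrite !mul0r ?(add0r, addr0).
Qed.

Lemma mulmxJE (A : 'M[F]_4) (i j : 'I_4) :
  (A *m J) i j = (if (j < 2)%N then -1 else 1) * A i (rev_ord j).
Proof.
rewrite mxE sum_ord4 !JE; move: j; elim/ord4_ind; rewrite /= rev_ord4E;
  by rewrite !mulr0 ?(add0r, addr0) mulrC.
Qed.

(** Since J^2 = -1, the inverse is -mu^-1 J g^T J. *)
Lemma invmx_similitudeE g mu (i j : 'I_4) : mu != 0 -> g^T *m J *m g = mu *: J ->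
  invmx g i j = (if (i < 2)%N == (j < 2)%N then mu^-1 else - mu^-1) * g (rev_ord j) (rev_ord i).
Proof.
move=> mu0 gs; have ug := similitude_unitmx mu0 gs.
have -> : invmx g = - mu^-1 *: (J *m (g^T *m J)).
  rewrite -[RHS](mulmxK ug) (_ : _ *: _ *m g = 1%:M) ?mul1mx //.
  rewrite -scalemxAl -!mulmxA (mulmxA g^T) gs -scalemxAr JJ.
  by rewrite !scalerN scalerA mulNr scaleNr opprK mulVf // scale1r.
rewrite mxE mulJmxE mulmxJE mxE; case: ifP; case: ifP => _ _ /=; ring.
Qed.

Lemma gramE g (i j : 'I_4) : (g^T *m J *m g) i j =
  g o0 i * g o3 j + g o1 i * g o2 j - g o2 i * g o1 j - g o3 i * g o0 j.
Proof. by rewrite -mulmxA mxE sum_ord4 !mulJmxE !mxE /= !rev_ord4E; ring. Qed.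

Lemma similitude_factor g mu : g^T *m J *m g = mu *: J ->
  mu = g o0 o0 * g o3 o3 + g o1 o0 * g o2 o3 - g o2 o0 * g o1 o3 - g o3 o0 * g o0 o3.
Proof. by rewrite -gramE => ->; rewrite mxE JE /= mulr1. Qed.

Lemma similitude_factor_uniq g mu mu' :
  g^T *m J *m g = mu *: J -> g^T *m J *m g = mu' *: J -> mu = mu'.
Proof. by move=> /similitude_factor -> /similitude_factor ->. Qed.

(** Modulo p, mu reduces to the product of the diagonal entries at 0 and 3. *)
Lemma Kprime_factor g mu : Kprime g -> g^T *m J *m g = mu *: J -> mu - 1 \in pow_p 1.
Proof.
move=> [_ gK] /similitude_factor ->.
have := gK o0 o0; have := gK o3 o3; have := gK o1 o0; have := gK o2 o3.
have := gK o2 o0; have := gK o1 o3; have := gK o3 o0; have := gK o0 o3.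
rewrite /= !subr0 => g03 g30 g13 g20 g23 g10 g33 g00.
have -> : g o0 o0 * g o3 o3 + g o1 o0 * g o2 o3 - g o2 o0 * g o1 o3 - g o3 o0 * g o0 o3 - 1
  = (g o0 o0 - 1) * (g o3 o3 - 1) + (g o0 o0 - 1) + (g o3 o3 - 1)
    + g o1 o0 * g o2 o3 - g o2 o0 * g o1 o3 - g o3 o0 * g o0 o3 by ring.
apply: pow_pB; last exact: (pow_pM_le _ g30 g03).
apply: pow_pB; last exact: (pow_pM_le _ g20 g13).
apply: pow_pD; last exact: (pow_pM_le _ g10 g23).
by do 2!(apply: pow_pD => //); apply: (pow_pM_le _ g00 g33).
Qed.

Lemma valeq_add1 (x : F) : x - 1 \in pow_p 1 -> valeq 0 x.
Proof. by move=> x1; rewrite -[x](subrK 1) addrC; apply: valeqDl (valeq1 F) _. Qed.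

(** Expanding around the identity separates the additive part of a product from a quadratic
    error. *)
Lemma mulmx_sub1E k k' (i j : 'I_4) : (k *m k') i j - (i == j)%:R =
  \sum_l (k i l - (i == l)%:R) * (k' l j - (l == j)%:R)
  + (k i j - (i == j)%:R) + (k' i j - (i == j)%:R).
Proof.
have -> : k *m k' = (k - 1%:M) *m (k' - 1%:M) + (k - 1%:M) + (k' - 1%:M) + 1%:M.
  rewrite mulmxBl mulmxBr mul1mx mulmx1; apply/matrixP => a b.
  by rewrite !mxE; ring.
rewrite !mxE addrK; congr (_ + _ + _).
by apply: eq_bigr => l _; rewrite !mxE.
Qed.

Lemma KprimeM k k' : Kprime k -> Kprime k' -> Kprime (k *m k').
Proof.
move=> [Gk Kk] [Gk' Kk']; split; first exact: GSp4M.
move=> i j; rewrite mulmx_sub1E.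
apply: pow_pD; last exact: Kk'; apply: pow_pD; last exact: Kk.
apply: pow_p_sum => l; apply: pow_pM_le (Kk i l) (Kk' l j).
by do 3!case: ltnP => ?; rewrite //=; lia.
Qed.

Lemma KprimeV k : Kprime k -> Kprime (invmx k).
Proof.
move=> Kk; have [Gk kK] := Kk; split; first exact: GSp4V.
move=> i j; have [_ [mu mu0 ks]] := Gk.
have mu1 := Kprime_factor Kk ks.
have vmuV : valeq 0 mu^-1 by have := valeqV (valeq_add1 mu1); rewrite oppr0.
rewrite (invmx_similitudeE _ _ mu0 ks); have := kK (rev_ord j) (rev_ord i).
rewrite (inj_eq rev_ord_inj) eq_sym; case: eqVneq => [->|ij].
  rewrite eqxx !ltnn => kj.
  have -> : mu^-1 * k (rev_ord j) (rev_ord j) - 1 =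
    mu^-1 * ((k (rev_ord j) (rev_ord j) - 1) - (mu - 1)) by field.
  by rewrite (pow_pZ _ _ vmuV) subr0; apply: pow_pB.
rewrite !subr0 => kij.
have {}kij : k (rev_ord j) (rev_ord i) \in pow_p (if (i < j)%N then 0 else 1 : int).
  rewrite (_ : (i < j)%N = (rev_ord j < rev_ord i)%N) //=.
  by have := ltn_ord i; have := ltn_ord j; lia.
have vmuV' : valeq 0 (- mu^-1) by rewrite valeqN.
by case: ifP => _; rewrite ?(pow_pZ _ _ vmuV') ?(pow_pZ _ _ vmuV) subr0.
Qed.

(** The determinant condition becomes one on the similitude factor because det^2 = mu^4. *)
Lemma paramodularP n k : paramodular n k <-> exists mu,
  [/\ valeq 0 mu, k^T *m J *m k = mu *: J
   & forall i j : 'I_4, k i j \in pow_p (paramodular_exponent n i j)].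
Proof.
split=> [[[_ [mu mu0 ks]] Kk dk]|[mu [vmu ks Kk]]].
  exists mu; split=> //; have := valeqX 4 (valeq_valuation mu0).
  rewrite -(det_similitude ks) => /andP[_ /eqP].
  have /andP[_ /eqP ->] := valeqX 2 (dk : valeq 0 _).
  by rewrite /valeq mu0 mul0r => /esym/eqP; rewrite mulf_eq0 orbF.
split; [exact: similitude_GSp4 (valeq_neq0 vmu) ks|by []|].
exact: det_similitude_unit vmu ks.
Qed.

Lemma paramodular_exponent_le n (i l j : 'I_4) : paramodular_exponent n i j <=
  paramodular_exponent n i l + paramodular_exponent n l j.
Proof.
by move: i l j; do 3!elim/ord4_ind; rewrite /paramodular_exponent /=; lia.
Qed.

Lemma paramodularM n k k' : paramodular n k -> paramodular n k' -> paramodular n (k *m k').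
Proof.
rewrite !paramodularP => -[mu [vmu ks Kk]] [mu' [vmu' ks' Kk']].
exists (mu * mu'); split; first by have := valeqM vmu vmu'; rewrite addr0.
  exact: similitudeM.
move=> i j; rewrite mxE; apply: pow_p_sum => l.
by apply: pow_pM_le (Kk i l) (Kk' l j); apply: paramodular_exponent_le.
Qed.

Lemma paramodularV n k : paramodular n k -> paramodular n (invmx k).
Proof.
rewrite !paramodularP => -[mu [vmu ks Kk]]; have mu0 := valeq_neq0 vmu.
exists mu^-1; split; [by have := valeqV vmu; rewrite oppr0|exact: similitudeV|].
move=> i j; rewrite (invmx_similitudeE _ _ mu0 ks).
have vV : valeq 0 mu^-1 by have := valeqV vmu; rewrite oppr0.
have vV' : valeq 0 (- mu^-1) by rewrite valeqN.
have kij : k (rev_ord j) (rev_ord i) \in pow_p (paramodular_exponent n i j).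
  by have := Kk (rev_ord j) (rev_ord i); move: i j; do 2!elim/ord4_ind.
by case: ifP => _; rewrite ?(pow_pZ _ _ vV') ?(pow_pZ _ _ vV) subr0.
Qed.

Lemma paramodular_unitmx n k : paramodular n k -> k \in unitmx.
Proof. by case=> -[]. Qed.

End Groups.

(** * Multiplicativity of the extended character on H' *)

Section InducingCharacter.
Variables (R : realType) (F : localFieldType) (psi : F -> R[i]) (varpi t : F).
Hypothesis psi_char : additive_character psi.
Hypothesis psi_triv : trivial_exactly_on_o psi.
Hypothesis varpi_unif : uniformizer varpi.
Hypothesis t_unit : o_unit t.
Variable eps : R[i].
Hypothesis eps_sq : eps * eps = 1.
Implicit Types (k s : 'M[F]_4) (b : bool).
Local Notation J := (J F).
Local Notation psi0 := (psi0 psi varpi).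
Local Notation chi_pm := (chi_pm psi varpi t eps).
Local Notation Hprime := (Hprime varpi t).
Local Notation g_chi := (g_chi varpi t).

Let varpi_neq0 : varpi != 0 := valeq_neq0 varpi_unif.
Let t_neq0 : t != 0 := valeq_neq0 t_unit.

Definition affine_coord k := k o0 o1 + k o1 o2 + t * varpi^-1 * k o3 o0.

Lemma psi0_congr x y : x - y \in pow_p 1 -> psi0 x = psi0 y.
Proof. by move=> xy; rewrite -[x](subrK y) psi0D // psi0_p // mul1r. Qed.

Lemma pow_p_t_varpiV n x : (t * varpi^-1 * x \in pow_p n) = (x \in pow_p (n + 1)).
Proof. by rewrite -mulrA (pow_pZ _ _ t_unit) (pow_pZ _ _ (valeqV varpi_unif)) subr0 opprK. Qed.

(** The quadratic errors lie in p for the entries (0,1) and (1,2), and in p^2 for (3,0), which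
    compensates the factor varpi^-1. *)
Lemma affine_coordM k k' : Kprime k -> Kprime k' ->
  psi0 (affine_coord (k *m k')) = psi0 (affine_coord k) * psi0 (affine_coord k').
Proof.
move=> [_ Kk] [_ Kk']; rewrite -psi0D //; apply: psi0_congr.
have small (i j : 'I_4) m : i != j ->
    (forall l : 'I_4, m <= (if (i < l)%N then 0 else 1) + (if (l < j)%N then 0 else 1) :> int) ->
    (k *m k') i j - (k i j + k' i j) \in pow_p m.
  move=> ij hm; have := mulmx_sub1E k k' i j; rewrite (negPf ij) !subr0 => ->.
  rewrite -[X in X - _]addrA addrK; apply: pow_p_sum => l.
  exact: pow_pM_le (hm l) (Kk i l) (Kk' l j).
have s01 := small o0 o1 1 isT; have s12 := small o1 o2 1 isT.
have s30 := small o3 o0 2 isT.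
have -> : affine_coord (k *m k') - (affine_coord k + affine_coord k') =
  ((k *m k') o0 o1 - (k o0 o1 + k' o0 o1)) + ((k *m k') o1 o2 - (k o1 o2 + k' o1 o2))
  + t * varpi^-1 * ((k *m k') o3 o0 - (k o3 o0 + k' o3 o0)).
  by rewrite /affine_coord; ring.
apply: pow_pD; last by rewrite pow_p_t_varpiV; apply: s30; elim/ord4_ind.
by apply: pow_pD; [apply: s01; elim/ord4_ind|apply: s12; elim/ord4_ind].
Qed.

(** [g_chi] is monomial, so conjugation only permutes and rescales entries; it normalizes K' and
    preserves the character. *)
Lemma g_chi_conj k : Kprime k -> exists k', [/\ Kprime k', k *m g_chi = g_chi *m k'
  & psi0 (affine_coord k') = psi0 (affine_coord k)].
Proof.
move=> Kk; have [Gk kK] := Kk.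
pose a := varpi / t; have va : valeq 1 a := varpi_t_valeq varpi_unif t_unit.
have a0 := valeq_neq0 va.
(* Column i of [g_chi] has its only nonzero entry [c i] in row [r i]. *)
pose c (i : 'I_4) : F := nth 0 [:: - a; a; 1; -1] i.
pose r (i : 'I_4) : 'I_4 := nth o0 [:: o2; o3; o0; o1] i.
pose k' : 'M[F]_4 := \matrix_(i, j) (c j / c i * k (r i) (r j)).
have kg : k *m g_chi = g_chi *m k'.
  apply/matrixP => i j; rewrite !mxE !sum_ord4 !mxE -/a.
  by move: i j; do 2!elim/ord4_ind; rewrite /c /r /=; field; rewrite ?oppr_eq0 ?oner_eq0 ?a0.
have k'E : k' = invmx g_chi *m (k *m g_chi).
  by rewrite kg mulKmx // g_chi_unit.
have Gg : GSp4 g_chi.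
  apply: (similitude_GSp4 _ (g_chi_similitude varpi t)).
  by rewrite oppr_eq0.
have Gk' : GSp4 k' by rewrite k'E; apply: GSp4M; [apply: GSp4V|apply: GSp4M].
exists k'; split=> //.
  split=> // i j; rewrite mxE.
  have [<-|ij] := eqVneq i j.
    rewrite divff ?mul1r; first by have := kK (r i) (r i); rewrite eqxx !ltnn.
    by move: i; elim/ord4_ind; rewrite /c /= ?oppr_eq0 ?oner_eq0.
  have rij : r i != r j by apply: contraNneq ij => /(congr1 val); move: i j; do 2!elim/ord4_ind.
  have := kK (r i) (r j); rewrite (negPf rij) !subr0.
  pose v (i : 'I_4) : int := nth 0 [:: 1; 1; 0; 0] i.
  have vc l : valeq (v l) (c l).
    by move: l; elim/ord4_ind; rewrite /c /v /= ?valeqN //; apply: valeq1.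
  rewrite (pow_pZ _ _ (valeqM (vc j) (valeqV (vc i)))); apply: pow_p_le.
  by move: i j ij {rij}; do 2!elim/ord4_ind.
(* Conjugation exchanges the contributions of k_12 and k_30 and replaces k_01 by -k_23; the (1,3)
   entry of the similitude equation shows that k_01 + k_23 lies in p. *)
apply: psi0_congr.
have [_ [mu mu0 ks]] := Gk.
have := congr1 (fun A : 'M[F]_4 => A o1 o3) ks; rewrite /= gramE mxE JE /= mulr0 => e.
have -> : affine_coord k' - affine_coord k =
    k o0 o1 * (k o3 o3 - 1) + (k o1 o1 - 1) * k o2 o3 - k o2 o1 * k o1 o3 - k o3 o1 * k o0 o3.
  have -> : k o0 o1 * (k o3 o3 - 1) + (k o1 o1 - 1) * k o2 o3
      - k o2 o1 * k o1 o3 - k o3 o1 * k o0 o3 = - (k o0 o1 + k o2 o3).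
    by apply/eqP; rewrite -subr_eq0 opprK -e; apply/eqP; ring.
  by rewrite /affine_coord !mxE /c /r /= /a; field; rewrite !oppr_eq0 oner_eq0 varpi_neq0 t_neq0.
have := kK o0 o1; have := kK o3 o3; have := kK o1 o1; have := kK o2 o3.
have := kK o2 o1; have := kK o1 o3; have := kK o3 o1; have := kK o0 o3.
rewrite /= !subr0 => k03 k31 k13 k21 k23 k11 k33 k01.
apply: pow_pB; last exact: (pow_pM_le _ k31 k03).
apply: pow_pB; last exact: (pow_pM_le _ k21 k13).
by apply: pow_pD; [exact: (pow_pM_le _ k01 k33)|exact: (pow_pM_le _ k11 k23)].
Qed.

(** Boolean exponents suffice because the square of [g_chi] is scalar. *)
Definition g_chi_pow b := if b then g_chi else 1%:M.

Lemma g_chi_pow_conj b k : Kprime k -> exists k',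
  [/\ Kprime k', k *m g_chi_pow b = g_chi_pow b *m k'
    & psi0 (affine_coord k') = psi0 (affine_coord k)].
Proof.
move=> Kk; case: b; first exact: g_chi_conj.
by exists k; rewrite mulmx1 mul1mx.
Qed.

Lemma g_chi_sq : g_chi *m g_chi = - (varpi / t) *: 1%:M.
Proof.
apply/matrixP => i j; rewrite !mxE sum_ord4 !mxE.
by move: i j; do 2!elim/ord4_ind; rewrite /=; ring.
Qed.

Lemma g_chi_powM b b' : exists2 w, w != 0 &
  g_chi_pow b *m g_chi_pow b' = w *: g_chi_pow (b (+) b').
Proof.
case: b; case: b' => /=; last by exists 1; rewrite ?oner_neq0 // mulmx1 scale1r.
- exists (- (varpi / t)); last exact: g_chi_sq.
  by rewrite oppr_eq0 mulf_neq0 ?invr_eq0.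
- by exists 1; rewrite ?oner_neq0 // mulmx1 scale1r.
- by exists 1; rewrite ?oner_neq0 // mul1mx scale1r.
Qed.

Lemma HprimeP s : Hprime s <-> exists b z k,
  [/\ z != 0, Kprime k & s = z *: (g_chi_pow b *m k)].
Proof.
split=> [[[z [k [z0 Kk ->]]]|[_ [z [k [z0 Kk ->]]] <-]]|[[] [z [k [z0 Kk ->]]]]].
- by exists false, z, k; rewrite mul1mx.
- by exists true, z, k; rewrite scalemxAr.
- by right; exists (z *: k); [exists z, k|rewrite scalemxAr].
- by left; exists z, k; rewrite mul1mx.
Qed.

Lemma chi_pm_val b z k : z != 0 -> Kprime k ->
  chi_pm (z *: (g_chi_pow b *m k)) = eps ^+ b * psi0 (affine_coord k).
Proof.
move=> z0 Kk; have Hzk : H (z *: k) by exists z, k.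
have chi_zk : chi psi varpi t (z *: k) = psi0 (affine_coord k).
  by rewrite chiE // chi_KprimeE.
have [c1 c2] := chi_pmE psi eps varpi_neq0 t_neq0 Hzk.
by case: b; rewrite /= scalemxAr; [rewrite c2|rewrite mul1mx c1 mul1r]; rewrite chi_zk.
Qed.

(** Moving [g_chi] past K' preserves the character, and its scalar square has value 1 = eps^2. *)
Lemma chi_pmM s s' : Hprime s -> Hprime s' ->
  Hprime (s *m s') /\ chi_pm (s *m s') = chi_pm s * chi_pm s'.
Proof.
move=> /HprimeP[b [z [k [z0 Kk ->]]]] /HprimeP[b' [z' [k' [z'0 Kk' ->]]]].
have [k1 [Kk1 kg psi_k1]] := g_chi_pow_conj b' Kk.
have [w w0 bb'] := g_chi_powM b b'.
have -> : z *: (g_chi_pow b *m k) *m (z' *: (g_chi_pow b' *m k')) =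
    (z * z' * w) *: (g_chi_pow (b (+) b') *m (k1 *m k')).
  rewrite -scalemxAl -scalemxAr scalerA -!mulmxA (mulmxA k) kg !mulmxA bb'.
  by rewrite -!scalemxAl scalerA.
have Kk1k' := KprimeM Kk1 Kk'.
have zw0 : z * z' * w != 0 by rewrite !mulf_neq0.
split; first by apply/HprimeP; exists (b (+) b'), (z * z' * w), (k1 *m k').
rewrite !chi_pm_val // affine_coordM // psi_k1 mulrACA; congr (_ * _).
by case: b {kg bb'}; case: b' => //=; rewrite ?mulr1 ?mul1r // expr1 eps_sq.
Qed.

Lemma HprimeV s : Hprime s -> Hprime (invmx s).
Proof.
move=> /HprimeP[b [z [k [z0 Kk ->]]]].
have [k1 [Kk1 kg _]] := g_chi_pow_conj b (KprimeV Kk).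
have [w w0] := g_chi_powM b b; rewrite addbb => bb.
have zw0 : (z * w)^-1 != 0 by rewrite invr_eq0 mulf_neq0.
have [[uk _] _] := Kk.
set s0 := z *: _; set s' := (z * w)^-1 *: (g_chi_pow b *m k1).
have s's : s' *m s0 = 1%:M.
  rewrite /s0 /s' -scalemxAl -scalemxAr scalerA -kg -!mulmxA (mulmxA (g_chi_pow b)) bb.
  rewrite -scalemxAl mul1mx -scalemxAr mulVmx // scalerA -mulrA mulVf ?scale1r //.
  by rewrite mulf_neq0.
have [_ us] := mulmx1_unit s's.
apply/HprimeP; exists b, (z * w)^-1, k1; split=> //.
by rewrite -/s' -[s']mulmx1 -(mulmxV us) mulmxA s's mul1mx.
Qed.

Lemma Hprime_similitude s : Hprime s -> exists2 mu, mu != 0 & s^T *m J *m s = mu *: J.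
Proof.
move=> /HprimeP[b [z [k [z0 [[_ [mu mu0 ks]] _] ->]]]].
have [mub mub0 bs] : exists2 mu, mu != 0 & (g_chi_pow b)^T *m J *m g_chi_pow b = mu *: J.
  case: b.
    exists (- (varpi / t)); last exact: g_chi_similitude.
    by rewrite oppr_eq0 mulf_neq0 ?invr_eq0.
  by exists 1; rewrite ?oner_neq0 // trmx1 mul1mx mulmx1 scale1r.
exists (z ^+ 2 * (mub * mu)); last exact/similitudeZ/similitudeM.
by rewrite !mulf_neq0 ?expf_neq0.
Qed.

Lemma Hprime_GSp4 s : Hprime s -> GSp4 s.
Proof. by move=> /Hprime_similitude[mu mu0]; apply: similitude_GSp4. Qed.

End InducingCharacter.

(** * A fixed vector of level 5 *)

Section FiniteResidues.
Variables (F : localFieldType) (varpi : F).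
Hypothesis varpi_unif : uniformizer varpi.

(** Induction on the number of digits: each step adds a multiple of varpi^(a + n) by a residue
    representative. *)
Lemma finite_residues (a : int) (n : nat) : exists s : seq F,
  forall x, x \in pow_p a -> exists2 y, y \in s & x - y \in pow_p (a + n%:Z).
Proof.
elim: n => [|n [s hs]].
  by exists [:: 0] => x xa; exists 0; rewrite ?mem_head // subr0 addr0.
have [s0 hs0] := @residue_finite F.
pose w := varpi ^ (a + n%:Z); have vw : valeq (a + n%:Z) w := valeq_varpi varpi_unif _.
exists [seq y + w * r | y <- s, r <- s0] => x /hs[y ys xy].
have [|r rs r_eq] := hs0 (w^-1 * (x - y)).
  have := pow_pZ 0 (x - y) (valeqV vw); rewrite sub0r opprK xy inE.
  by case/orP => [/eqP|]; [left|right].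
exists (y + w * r); first by apply/allpairsP; exists (y, r).
have -> : x - (y + w * r) = w * (w^-1 * (x - y) - r).
  by field; apply: valeq_neq0 vw.
have e1 : a + n.+1%:Z - (a + n%:Z) = 1 by lia.
rewrite (pow_pZ _ _ vw) e1 inE.
by case: r_eq => [->|->]; rewrite ?subrr ?eqxx ?orbT.
Qed.

Lemma finite_residues_mx (a : int) (n : nat) : exists2 B : set 'M[F]_4, finite_set B &
  forall k : 'M[F]_4, (forall i j, k i j \in pow_p a) ->
  exists2 b, B b & forall i j, k i j - b i j \in pow_p (a + n%:Z).
Proof.
have [s hs] := finite_residues a n.
exists [set map_mx val M | M in [set: 'M[seq_sub s]_4]]%classic.
  exact/finite_image/finite_finset.
move=> k ka.
have /fin_all_exists[y ky] (p : 'I_4 * 'I_4) : exists y : seq_sub s,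
    k p.1 p.2 - val y \in pow_p (a + n%:Z).
  by have [y ys ky] := hs _ (ka p.1 p.2); exists (SeqSub ys).
exists (map_mx val (\matrix_(i, j) y (i, j))); first by exists (\matrix_(i, j) y (i, j)).
by move=> i j; rewrite !mxE; apply: (ky (i, j)).
Qed.

Lemma nbhs1_congruence (n : int) :
  nbhs (1%:M : 'M[F]_4)
    [set k : 'M[F]_4 | forall i j : 'I_4, k i j - (i == j)%:R \in pow_p n]%classic.
Proof.
rewrite mx_ent_nbhsE.
pose P := [set xy : F * F | xy.1 - xy.2 \in pow_p n]%classic.
exists [set MN : 'M[F]_4 * 'M[F]_4 | forall i j, P (MN.1 i j, MN.2 i j)]%classic.
  exists (fun _ _ => P) => // _ _; apply/entourage_val; exists n => x y xy.
  by rewrite /P /= inE subr_eq0; case: xy => [->|->]; rewrite ?eqxx ?orbT.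
move=> k; rewrite /xsection /= inE => Pk i j.
by have := pow_pN (Pk i j); rewrite /P /= mxE opprB.
Qed.

End FiniteResidues.

(** * The function supported on H' g K(p^5) *)

Section NewVector.
Variables (R : realType) (F : localFieldType) (psi : F -> R[i]) (varpi t : F).
Hypothesis psi_char : additive_character psi.
Hypothesis psi_triv : trivial_exactly_on_o psi.
Hypothesis varpi_unif : uniformizer varpi.
Hypothesis t_unit : o_unit t.
Variable eps : R[i].
Hypothesis eps_sq : eps * eps = 1.
Implicit Types (k s x : 'M[F]_4).
Local Notation J := (J F).
Local Notation chi_pm := (chi_pm psi varpi t eps).
Local Notation Hprime := (Hprime varpi t).
Local Notation K5 := (paramodular 5).

Let chiM := chi_pmM psi_char psi_triv varpi_unif t_unit eps_sq.
Let HV := HprimeV psi_char psi_triv varpi_unif t_unit.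
Let HG := Hprime_GSp4 varpi_unif t_unit.

Definition depth (i : 'I_4) : int := 3 - i%:Z.

Definition g_new : 'M[F]_4 := diag_mx (\row_i varpi ^ depth i).

Lemma g_new_similitude : g_new^T *m J *m g_new = varpi ^ 3 *: J.
Proof.
have w0 := valeq_neq0 varpi_unif.
rewrite tr_diag_mx; apply/matrixP => i j.
rewrite mul_mx_diag mul_diag_mx !mxE mulrAC -expfzDr //.
by move: i j; do 2!elim/ord4_ind; rewrite /= ?mulr0.
Qed.

Lemma g_new_GSp4 : GSp4 g_new.
Proof. exact: similitude_GSp4 (valeq_neq0 (valeq_varpi varpi_unif _)) g_new_similitude. Qed.

Lemma g_new_unitmx : g_new \in unitmx.
Proof. by case: g_new_GSp4. Qed.

Lemma g_new_conj w k (i j : 'I_4) : w *m g_new = g_new *m k ->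
  w i j = varpi ^ (j%:Z - i%:Z) * k i j.
Proof.
have w0 := valeq_neq0 varpi_unif.
move=> /(congr1 (fun A : 'M[F]_4 => A i j)); rewrite mul_mx_diag mul_diag_mx !mxE => e.
apply: (mulIf (valeq_neq0 (valeq_varpi varpi_unif (depth j)))).
rewrite e mulrAC -expfzDr //; congr (_ ^ _ * _); rewrite /depth; lia.
Qed.

(* The similitude factor of w is a unit, which excludes w in g_chi H. *)
Lemma chi_pm_stabilizer w k : Hprime w -> K5 k -> w *m g_new = g_new *m k -> chi_pm w = 1.
Proof.
move=> Hw Kk wk; have [mu [vmu ks kK]] := (paramodularP 5 k).1 Kk.
have w0 := valeq_neq0 varpi_unif; have t0 := valeq_neq0 t_unit.
have [b [z [k0 [z0 Kk0 wE]]]] := (HprimeP varpi t w).1 Hw.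
have [_ [mu0 mu0_neq0 k0s]] := Kk0.1.
have vmu0 := valeq_add1 (Kprime_factor Kk0 k0s).
pose mub := if b then - (varpi / t) else 1.
have bs : (g_chi_pow varpi t b)^T *m J *m g_chi_pow varpi t b = mub *: J.
  rewrite /mub; case: b {mub wE}; first exact: g_chi_similitude.
  by rewrite trmx1 mul1mx mulmx1 scale1r.
have vmub : valeq b%:Z mub.
  by rewrite /mub; case: b {mub wE bs}; rewrite ?valeqN; [apply: varpi_t_valeq|apply: valeq1].
have ws : w^T *m J *m w = mu *: J.
  have ug := g_new_unitmx.
  have -> : w = g_new *m k *m invmx g_new by rewrite -wk mulmxK.
  have v30 := valeq_neq0 (valeq_varpi varpi_unif 3).
  have := similitudeM (similitudeM g_new_similitude ks) (similitudeV v30 g_new_similitude).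
  by rewrite mulrAC divff // mul1r.
have wmu : mu = z ^+ 2 * (mub * mu0).
  by apply: similitude_factor_uniq ws _; rewrite wE; apply/similitudeZ/similitudeM.
have vz := valeq_valuation z0.
have := valeqM (valeqX 2 vz) (valeqM vmub vmu0); rewrite -wmu.
have /andP[_ /eqP vmu'] := vmu; rewrite /valeq vmu' => /andP[_ /eqP vb].
(* Comparing similitude factors gives 2 val(z) + b = 0, so parity forces b = 0. *)
have {vb} [b0 vz0] : b = false /\ valuation z = 0.
  by move: vb; case: (b) => /=; lia.
rewrite vz0 in vz; rewrite {}b0 in wE.
have k0E (i j : 'I_4) m : m <= paramodular_exponent 5 i j + (j%:Z - i%:Z) -> k0 i j \in pow_p m.
  move=> hm; have := g_new_conj i j wk; rewrite wE mul1mx mxE => zk0.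
  rewrite -(subr0 m) -(pow_pZ _ _ vz) zk0 mulrC.
  by apply: pow_pM_le hm (kK i j) (valeq_pow_p (valeq_varpi varpi_unif _)).
rewrite wE chi_pm_val // expr0 mul1r psi0_p // /affine_coord.
apply: pow_pD; last by rewrite pow_p_t_varpiV //; apply: k0E.
by apply: pow_pD; apply: k0E.
Qed.

(** The default value 0 extends the function outside the double coset; independence of the
    decomposition is [new_vectorE]. *)
Definition new_vector x : R[i] := xget 0 [set c | exists s k,
  [/\ Hprime s, K5 k, x = s *m g_new *m k & c = chi_pm s]]%classic.

(** Two decompositions differ by an element of H' that g_new conjugates into K(p^5), where the
    character is trivial. *)
Lemma new_vectorE s k : Hprime s -> K5 k -> new_vector (s *m g_new *m k) = chi_pm s.
Proof.
move=> Hs Kk; apply: xget_unique; first by exists s, k.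
move=> _ [s' [k' [Hs' Kk' e ->]]].
have us : s \in unitmx by case: (HG Hs).
have uk' := paramodular_unitmx Kk'.
have [Hw chiw] := chiM (HV Hs) Hs'.
have Kw := paramodularM Kk (paramodularV Kk').
have wg : invmx s *m s' *m g_new = g_new *m (k *m invmx k').
  rewrite -(mulKmx us (g_new *m (k *m invmx k'))) (mulmxA s) (mulmxA (s *m g_new)) e.
  by rewrite mulmxK // !mulmxA.
have chi1 := chi_pm_stabilizer Hw Kw wg.
have [_] := chiM Hs Hw; rewrite mulKVmx // chi1 mulr1.
by move=> ->.
Qed.

Definition new_vector_support x :=
  exists s k, [/\ Hprime s, K5 k & x = s *m g_new *m k].

Lemma new_vector_out x : ~ new_vector_support x -> new_vector x = 0.
Proof.
by move=> nx; apply: xgetPN => c [s [k [Hs Kk xE _]]]; apply: nx; exists s, k.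
Qed.

Lemma new_vector_in x : new_vector x != 0 -> new_vector_support x.
Proof. by move=> nx; apply: contrapT => /new_vector_out/eqP; apply/negP. Qed.

Lemma new_vector_support_GSp4 x : new_vector_support x -> GSp4 x.
Proof.
move=> [s [k [Hs [Gk _ _] ->]]]; apply: GSp4M => //.
exact: GSp4M (HG Hs) g_new_GSp4.
Qed.

Lemma new_vector_left s x : Hprime s -> new_vector (s *m x) = chi_pm s * new_vector x.
Proof.
move=> Hs; have us : s \in unitmx by case: (HG Hs).
have [[s' [k [Hs' Kk ->]]]|nx] := pselect (new_vector_support x).
  have [Hss' chiss'] := chiM Hs Hs'.
  by rewrite !mulmxA new_vectorE // new_vectorE // chiss'.
rewrite (new_vector_out nx) mulr0 new_vector_out // => -[s' [k [Hs' Kk sx]]].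
apply: nx; exists (invmx s *m s'), k; split=> //; first exact: (chiM (HV Hs) Hs').1.
by rewrite -(mulKmx us x) sx !mulmxA.
Qed.

Lemma new_vector_right k x : K5 k -> new_vector (x *m k) = new_vector x.
Proof.
move=> Kk; have uk := paramodular_unitmx Kk.
have [[s [k' [Hs Kk' ->]]]|nx] := pselect (new_vector_support x).
  by rewrite -mulmxA !new_vectorE //; apply: paramodularM.
rewrite (new_vector_out nx) new_vector_out // => -[s [k' [Hs Kk' xk]]].
apply: nx; exists s, (k' *m invmx k); split=> //.
  exact/paramodularM/paramodularV.
by rewrite mulmxA -xk mulmxK.
Qed.

Lemma congruence_paramodular k : GSp4 k ->
  (forall i j : 'I_4, k i j - (i == j)%:R \in pow_p 5) -> K5 k.
Proof.
move=> [_ [mu mu0 ks]] k5; apply/paramodularP; exists mu.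
have Kk : Kprime k.
  split; first exact: similitude_GSp4 mu0 ks.
  by move=> i j; apply: pow_p_le (k5 i j); case: ifP.
split=> //; first exact/valeq_add1/(Kprime_factor Kk).
move=> i j; rewrite -(subrK (i == j)%:R (k i j)); apply: pow_pD.
  by apply: pow_p_le (k5 i j); move: i j; do 2!elim/ord4_ind.
case: eqP => [->|_]; last exact: pow_p0.
by rewrite (valeq_mem _ (valeq1 F)); move: j; elim/ord4_ind.
Qed.

Lemma paramodular5_1 : K5 (1%:M : 'M[F]_4).
Proof.
apply: congruence_paramodular; first by case: (Kprime1 F).
by move=> i j; rewrite mxE subrr pow_p0.
Qed.

Lemma new_vector_smooth : smooth new_vector.
Proof.
have := nbhs1_congruence F 5; apply: filterS => k k5 Gk; apply/funext => x.
exact: (new_vector_right _ (congruence_paramodular Gk k5)).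
Qed.

Lemma paramodular5_pow k (i j : 'I_4) : K5 k -> k i j \in pow_p (- 5).
Proof.
by case=> _ kK _; apply: pow_p_le (kK i j); move: i j; do 2!elim/ord4_ind.
Qed.

(* Right multiplication by r^-1 costs at most 5 in valuation, and conjugation
   by g_new at most 3. *)
Lemma paramodular_coset k r : K5 k -> K5 r ->
  (forall i j : 'I_4, k i j - r i j \in pow_p 10) ->
  exists2 w, Kprime w & g_new *m k = w *m g_new *m r.
Proof.
move=> Kk Kr kr; have ur := paramodular_unitmx Kr.
pose w := g_new *m (k *m invmx r) *m invmx g_new.
have wg : w *m g_new = g_new *m (k *m invmx r) by rewrite /w mulmxKV ?g_new_unitmx.
exists w; last by rewrite wg -mulmxA mulmxKV.
split=> [|i j].
  apply: GSp4M; last exact: GSp4V g_new_GSp4.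
  by apply: GSp4M g_new_GSp4 _; case: (paramodularM Kk (paramodularV Kr)).
rewrite (g_new_conj _ _ wg).
have -> : k *m invmx r = (k - r) *m invmx r + 1%:M by rewrite mulmxBl mulmxV // subrK.
rewrite mxE [1%:M _ _]mxE mulrDr.
have -> : varpi ^ (j%:Z - i%:Z) * (i == j)%:R = (i == j)%:R :> F.
  by case: eqP => [->|_]; rewrite ?mulr0 // subrr expr0z mul1r.
rewrite addrK.
have small : ((k - r) *m invmx r) i j \in pow_p 5.
  rewrite mxE; apply: pow_p_sum => l; rewrite !mxE.
  exact: (pow_pM_le _ (kr i l) (paramodular5_pow l j (paramodularV Kr))).
apply: pow_pM_le (valeq_pow_p (valeq_varpi varpi_unif _)) small.
by have := ltn_ord i; case: ifP => _; lia.
Qed.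

(* The compact set is a finite set of representatives of K(p^5) modulo p^10,
   translated by g_new. *)
Lemma new_vector_compact : compact_support_mod Hprime new_vector.
Proof.
(* Entries of K(p^5) lie in p^-5, so 15 digits determine them modulo p^10. *)
have [B finB hB] := finite_residues_mx varpi_unif (- 5) 15.
pose near_b (b : 'M[F]_4) := [set k : 'M[F]_4 | K5 k /\
  forall i j : 'I_4, k i j - b i j \in pow_p 10]%classic.
(* The default 1 keeps every representative in K(p^5), even for residues that K(p^5) does not
   meet. *)
pose rep b := xget 1%:M (near_b b).
have Krep b : K5 (rep b).
  rewrite /rep; case: xgetP => [k _ []//|_]; exact: paramodular5_1.
exists [set g_new *m rep b | b in B]%classic; split.
- exact/finite_compact/finite_image.
- move=> _ [b _ <-]; apply: GSp4M g_new_GSp4 _.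
  by case: (Krep b).
move=> x /new_vector_in[s [k [Hs Kk ->]]].
have [b Bb kb] := hB k (fun i j => paramodular5_pow i j Kk).
have [Kr rb] : near_b b (rep b) by apply: (@xgetPex _ _ (near_b b)); exists k.
have [w Kw wE] : exists2 w, Kprime w & g_new *m k = w *m g_new *m rep b.
  apply: paramodular_coset => // i j.
  have -> : k i j - rep b i j = (k i j - b i j) - (rep b i j - b i j) by ring.
  by apply: pow_pB; [apply: kb|apply: rb].
exists (s *m w), (g_new *m rep b); split.
- by apply: (chiM Hs _).1; left; apply: H_Kprime.
- by exists b.
- by rewrite -mulmxA wE !mulmxA.
Qed.

Lemma new_vector_sigma : sigma_chi psi varpi t eps new_vector.
Proof.
split; [|by move=> s x Hs _; apply: new_vector_left|exact: new_vector_smooth|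
  exact: new_vector_compact].
by move=> x nGx; apply: new_vector_out => /new_vector_support_GSp4.
Qed.

Lemma sigma_chi_fixed_vector5 :
  has_fixed_vector (sigma_chi psi varpi t eps) (paramodular 5).
Proof.
exists new_vector; split; first exact: new_vector_sigma; last first.
  by move=> k Kk; apply/funext => x; apply: new_vector_right.
have H1 : Hprime (1%:M : 'M[F]_4) by left; apply/H_Kprime/Kprime1.
(* The zero function is excluded by the value at g_new, a value of [psi0], which never vanishes. *)
have := new_vectorE H1 paramodular5_1 => + e0; rewrite e0.
rewrite chi_pm_Kprime //; last exact: Kprime1.
by rewrite chi_KprimeE => /esym/eqP; rewrite (negPf (psi0_neq0 _ _ _ _)).
Qed.

End NewVector.

Theorem proposition2p11 (R : realType) (F : localFieldType)
    (psi : F -> R[i]) (varpi t : F)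
    (psi_char : additive_character psi)
    (psi_triv : trivial_exactly_on_o psi)
    (varpi_unif : uniformizer varpi)
    (t_unit : o_unit t) :
  conductor_exponent_is (sigma_chi psi varpi t 1) 5 /\
  conductor_exponent_is (sigma_chi psi varpi t (-1)) 5.
Proof.
split; split.
- by apply: sigma_chi_fixed_vector5 => //; rewrite mulr1.
- by move=> n; apply: sigma_chi_conductor_ge; rewrite ?oner_neq0.
- by apply: sigma_chi_fixed_vector5 => //; rewrite mulrNN mulr1.
- by move=> n; apply: sigma_chi_conductor_ge; rewrite ?oppr_eq0 ?oner_neq0.
Qed.
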